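(* Let $\alpha>1/2$ and let $\boldsymbol{\gamma}=(\gamma_u)_{u\subset\mathbb{N},|u|<\infty}$ be a collection of non-negative weights with $\gamma_\emptyset=1$. Let $\zeta$ denote the Riemann zeta function. Consider the multivariate approximation problem in the weighted Korobov spaces $H_{d,\alpha,\boldsymbol{\gamma}}$, $d\in\mathbb{N}$. 1. Suppose $\boldsymbol{\gamma}$ are product weights, i.e. $\gamma_u=\prod_{j\in u}\gamma_j$ for a sequence of non-negative numbers $(\gamma_j)_{j\ge1}$. If there exists $\lambda\in(1/\alpha,2)$ such that $$\sum_{j=1}^\infty\gamma_j^\lambda<\infty,$$ then the problem is strongly polynomially tractable both in the deterministic $L_\infty$ sense and in the randomized $L_2$ sense. 2. Suppose $\boldsymbol{\gamma}$ are POD (product and order-dependent) weights, i.e. $\gamma_u=\Gamma_{|u|}\prod_{j\in u}\gamma_j$ for sequences of non-negative numbers $(\gamma_j)_{j\ge1}$ and $(\Gamma_\ell)_{\ell\ge0}$. If there exist $c>0$ and $\lambda\in(1/\alpha,2)$ such that $$2\zeta(\alpha\lambda)\sum_{j=1}^\infty\gamma_j^\lambda<1\quad\text{and}\quad\Gamma_\ell\le c\,(\ell!)^{1/\lambda}\ \text{ for all }\ell\in\mathbb{N},$$ then the problem is strongly polynomially tractable both in the deterministic $L_\infty$ sense and in the randomized $L_2$ sense.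
   Context: **Weighted Korobov space.** For $\boldsymbol{k}\in\mathbb{Z}^d$ let $u=\mathrm{supp}(\boldsymbol{k})=\{j\in\{1,\ldots,d\}\mid k_j\ne0\}$ and $r_{\alpha,\boldsymbol{\gamma}}(\boldsymbol{k})=\frac{1}{\gamma_u}\prod_{j\in u}|k_j|^\alpha$ (empty product $=1$; if $\gamma_u=0$, then $r_{\alpha,\boldsymbol{\gamma}}(\boldsymbol{k})=+\infty$ and $\widehat f(\boldsymbol{k})=0$ is required). $H_{d,\alpha,\boldsymbol{\gamma}}$ is the space of continuous functions $f$ on $[0,1]^d$, 1-periodic in each variable, with finite norm $\|f\|_{d,\alpha,\boldsymbol{\gamma}}=\big(\sum_{\boldsymbol{k}\in\mathbb{Z}^d}r_{\alpha,\boldsymbol{\gamma}}^2(\boldsymbol{k})|\widehat f(\boldsymbol{k})|^2\big)^{1/2}$, where $\widehat f(\boldsymbol{k})=\int_{[0,1]^d}f(\boldsymbol{x})e^{-2\pi i\boldsymbol{k}\cdot\boldsymbol{x}}\,\mathrm{d}\boldsymbol{x}$ (terms with $\gamma_u=0$ are omitted). **Errors.** A deterministic algorithm using $N$ function evaluations is a map $f\mapsto A_N(f)=\varphi(f(\boldsymbol{x}_1),\ldots,f(\boldsymbol{x}_N))$ with points $\boldsymbol{x}_1,\ldots,\boldsymbol{x}_N\in[0,1]^d$ and a map $\varphi$ into functions on $[0,1]^d$; its worst-case $L_\infty$ error is $\sup_{\|f\|_{d,\alpha,\boldsymbol{\gamma}}\le1}\sup_{\boldsymbol{x}\in[0,1]^d}|f(\boldsymbol{x})-A_N(f)(\boldsymbol{x})|$.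 A randomized algorithm using $N$ function evaluations is a random choice $A_{N,\omega}$ of such an algorithm (measurable in the random element $\omega$); its worst-case root mean squared $L_2$ error is $\sup_{\|f\|_{d,\alpha,\boldsymbol{\gamma}}\le1}\big(\mathbb{E}_\omega\|f-A_{N,\omega}(f)\|_{L_2([0,1]^d)}^2\big)^{1/2}$. **Tractability.** The information complexity $N(\varepsilon,d)$ is the minimal number of function evaluations required to reduce the worst-case error to at most $\varepsilon\in(0,1)$ for the $d$-dimensional problem (worst-case $L_\infty$ error over deterministic algorithms for the deterministic $L_\infty$ sense; worst-case root mean squared $L_2$ error over randomized algorithms for the randomized $L_2$ sense). The problem is strongly polynomially tractable if there are constants $C>0$ and $p\ge0$, independent of $\varepsilon$ and $d$, with $N(\varepsilon,d)\le C\varepsilon^{-p}$ for all $\varepsilon\in(0,1)$ and $d\in\mathbb{N}$. Here $\mathbb{N}$ is the set of positive integers. *)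

(* Defs.v *)
From HB Require Import structures.
From mathcomp Require Import all_boot all_order all_algebra finmap.
From mathcomp Require Import all_classical all_reals all_analysis.
From mathcomp Require Import complex.

Set Implicit Arguments.
Unset Strict Implicit.
Unset Printing Implicit Defensive.

Import Order.TTheory GRing.Theory Num.Theory.
Import numFieldNormedType.Exports.

Local Open Scope classical_set_scope.
Local Open Scope ring_scope.

(* Coordinates are numbered from 0: the coordinates 1, ..., d of the mathematics
   are the elements of 'I_d, a finite set u of positive integers is the finite
   set { j - 1 | j in u } : {fset nat}, and the weight gamma_j is g j.-1. *)

Section UnitCube.
Variable R : realType.

Definition unit_cube (d : nat) : set (d.-tuple R) :=
  [set x | forall i, 0 <= tnth x i <= 1].

Definition cons_point (d : nat) (p : measurableTypeR R * d.-tuple R) :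
  d.+1.-tuple R := [tuple of (p.1 : R) :: p.2].

Lemma measurable_cons_point (d : nat) : measurable_fun setT (@cons_point d).
Proof. by apply: measurable_cons => //; exact: measurable_fst. Qed.

HB.instance Definition _ (d : nat) :=
  isMeasurableFun.Build _ _ _ _ (@cons_point d) (@measurable_cons_point d).

(* Lebesgue measure on [0,1]^d, built as the d-fold product of the Lebesgue
   measure on [0,1] (uniform_prob ltr01). *)
Fixpoint cube_measure (d : nat) : probability (d.-tuple R) R :=
  match d with
  | 0 => @dirac _ _ [tuple] R
  | d'.+1 => distribution (uniform_prob (@ltr01 R) \x cube_measure d')%E
               (@cons_point d')
  end.

End UnitCube.
Arguments unit_cube R d : clear implicits.
Arguments cube_measure R d : clear implicits.

Section Korobov.
Variable R : realType.
Implicit Types (alpha : R) (gamma : {fset nat} -> R) (d : nat).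

(* A function on [0,1]^d that is 1-periodic in each variable is represented by
   its periodic extension to R^d.  'rV[R]_d carries the topology of R^d,
   d.-tuple R its Borel sigma-algebra. *)
Definition continuous_point d (f : d.-tuple R -> R[i]) : Prop :=
  let g (v : 'rV[R]_d) := f [tuple v ord0 i | i < d] in
  continuous (fun v => complex.Re (g v)) /\
  continuous (fun v => complex.Im (g v)).

Definition periodic_point d (f : d.-tuple R -> R[i]) : Prop :=
  forall (j : 'I_d) (x : d.-tuple R),
    f [tuple tnth x i + (i == j)%:R | i < d] = f x.

Definition expi (t : R) : R[i] := (cos t +i* sin t)%C.

Definition dotp d (k : {ffun 'I_d -> int}) (x : d.-tuple R) : R :=
  \sum_(i < d) (k i)%:~R * tnth x i.

Definition cube_integral d (h : d.-tuple R -> R[i]) : R[i] :=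
  ((\int[cube_measure R d]_(x in unit_cube R d) complex.Re (h x)) +i*
   (\int[cube_measure R d]_(x in unit_cube R d) complex.Im (h x)))%C.

Definition fourier d (f : d.-tuple R -> R[i]) (k : {ffun 'I_d -> int}) : R[i] :=
  cube_integral (fun x => f x * expi (- (2 * pi * dotp k x))).

Definition supp d (k : {ffun 'I_d -> int}) : {fset nat} :=
  [fset (nat_of_ord j) | j in 'I_d & k j != 0]%fset.

Definition korobov_r alpha gamma d (k : {ffun 'I_d -> int}) : \bar R :=
  if gamma (supp k) == 0 then +oo%E
  else ((gamma (supp k))^-1 *
        \prod_(j < d | k j != 0) (`|(k j)%:~R| `^ alpha))%:E.

(* In \bar R, +oo * 0 = 0 and +oo * x = +oo for x > 0, so the norm is finite
   only if the Fourier coefficients with gamma (supp k) = 0 vanish, and these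
   frequencies then contribute nothing. *)
Definition korobov_norm alpha gamma d (f : d.-tuple R -> R[i]) : \bar R :=
  sqrte (\esum_(k in [set: {ffun 'I_d -> int}])
           (korobov_r alpha gamma k ^+ 2 *
            (Normc.normc (fourier f k) ^+ 2)%:E))%E.

Definition korobov_space alpha gamma d : set (d.-tuple R -> R[i]) :=
  [set f | [/\ continuous_point f, periodic_point f &
               (korobov_norm alpha gamma f < +oo)%E]].

Definition korobov_ball alpha gamma d : set (d.-tuple R -> R[i]) :=
  [set f | korobov_space alpha gamma f /\
           (korobov_norm alpha gamma f <= 1)%E].

End Korobov.

Section Algorithms.
Variable R : realType.

(* The values of recon y outside [0,1]^d are irrelevant: every error below only
   looks at the unit cube. *)
Record algorithm (N d : nat) := Algorithm {
  node : 'I_N -> d.-tuple R;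
  node_cube : forall i, unit_cube R d (node i);
  recon : {ffun 'I_N -> R[i]} -> d.-tuple R -> R[i] }.

Definition run N d (A : algorithm N d) (f : d.-tuple R -> R[i]) :
  d.-tuple R -> R[i] := recon A [ffun i => f (node A i)].

Variables (alpha : R) (gamma : {fset nat} -> R).

Definition error_Linf N d (A : algorithm N d) : \bar R :=
  ereal_sup [set ereal_sup [set (Normc.normc (f x - run A f x))%:E
                           | x in unit_cube R d]
            | f in korobov_ball alpha gamma (d := d)].

(* Measurability of the random choice: for every input f, the output is
   measurable, jointly in the random element and in the evaluation point. *)
Definition randomized disp (Omega : measurableType disp) N d
    (A : Omega -> algorithm N d) : Prop :=
  forall f, korobov_space alpha gamma f ->
    measurable_fun ([set: Omega] `*` unit_cube R d)
      (fun p => complex.Re (run (A p.1) f p.2)) /\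
    measurable_fun ([set: Omega] `*` unit_cube R d)
      (fun p => complex.Im (run (A p.1) f p.2)).

Definition error_rms_L2 disp (Omega : measurableType disp)
    (P : probability Omega R) N d (A : Omega -> algorithm N d) : \bar R :=
  ereal_sup [set sqrte (\int[P]_w \int[cube_measure R d]_(x in unit_cube R d)
                    ((Normc.normc (f x - run (A w) f x)) ^+ 2)%:E)%E
            | f in korobov_ball alpha gamma (d := d)].

(* +oo when no number of function evaluations suffices. *)
Definition min_evaluations (S : set nat) : \bar R :=
  ereal_inf [set (N%:R)%:E | N in S].

Definition complexity_det_Linf (eps : R) (d : nat) : \bar R :=
  min_evaluations [set N | exists A : algorithm N d,
                             (error_Linf A <= eps%:E)%E].

Definition complexity_ran_L2 (eps : R) (d : nat) : \bar R :=
  min_evaluations [set N |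
    exists (disp : measure_display) (Omega : measurableType disp)
           (P : probability Omega R) (A : Omega -> algorithm N d),
      randomized A /\ (error_rms_L2 P A <= eps%:E)%E].

End Algorithms.

Section Tractability.
Variable R : realType.

Definition strongly_polynomially_tractable (comp : R -> nat -> \bar R) : Prop :=
  exists C p : R, [/\ 0 < C, 0 <= p &
    forall (eps : R) (d : nat), 0 < eps < 1 -> (0 < d)%N ->
      (comp eps d <= (C * eps `^ (- p))%:E)%E].

Definition product_weights (gamma : {fset nat} -> R) (g : nat -> R) : Prop :=
  forall u : {fset nat}, gamma u = \prod_(j <- u) g j.

Definition pod_weights (gamma : {fset nat} -> R) (Gam g : nat -> R) : Prop :=
  forall u : {fset nat}, gamma u = Gam #|` u|%fset * \prod_(j <- u) g j.

(* Riemann zeta at a real argument s > 1. *)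
Definition zeta (s : R) : \bar R :=
  (\sum_(1 <= n <oo) (n%:R `^ (- s))%:E)%E.

End Tractability.

(* Main.v *)
(* Write rho(k) = 1 / r(k), with rho(k) = 0 when gamma_(supp k) = 0.  Under
   either hypothesis, sum_k rho(k)^lambda is bounded by a constant that does not
   depend on d: grouping the k by support, this is a sum over u of
   gamma_u^lambda prod_(j in u) 2 zeta(alpha lambda), and l! times the l-th
   elementary symmetric polynomial is at most the l-th power of the sum.

   The algorithm approximates the Fourier coefficients with indices in
   A = {k : rho(k) >= 1/T} by a rank-1 lattice rule with N points, and is used
   both as a deterministic and as a (constant) randomized algorithm.  On a
   trigonometric polynomial of the unit ball, Cauchy-Schwarz bounds its squared
   L_infinity error by the sum of rho^2 over the complement of A plus an aliasing
   term; averaging the aliasing term over all generating vectors z in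
   {0, ..., N-1}^d gives a good z.  No primality of N is needed: frequencies
   h <> k with a nonzero |h_j - k_j| <= S collide with probability at most
   (S+1)/N, and the remaining h are so large that rho(h) is small.  All
   parameters can be chosen as powers of 1/eps.

   A general f of the ball is the pointwise limit of its Fejer means, which are
   averages of trigonometric polynomials of the ball, so the error bound carries
   over to f without any summation of Fourier series. *)

Require Import Defs.
From mathcomp Require Import all_boot all_order all_algebra finmap.
From mathcomp Require Import all_classical all_reals all_analysis.
From mathcomp Require Import measurable_realfun complex ring lra zify.
Set Implicit Arguments.
Unset Strict Implicit.
Unset Printing Implicit Defensive.
Import Order.TTheory GRing.Theory Num.Theory.
Import numFieldNormedType.Exports.
Local Open Scope classical_set_scope.
Local Open Scope ring_scope.

Local Notation freq d := {ffun 'I_d -> int}.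
Local Notation normc := Normc.normc.
Arguments supp : simpl never.

(** * Summability of the weights *)

(** Induction through (l+1) e_(l+1) <= e_1 e_l: a set of size l+1 arises in l+1 ways by adding an
    element j to a set of size l, and the pairs with j already in the set only add non-negative
    terms to the right side. *)
Lemma elementary_sum_le (R : realType) d (a : 'I_d -> R) (l : nat) :
  (forall j, 0 <= a j) ->
  l`!%:R * \sum_(u : {set 'I_d} | #|u| == l) \prod_(j in u) a j
    <= (\sum_j a j) ^+ l.
Proof.
move=> a0; elim: l => [|l IH].
  rewrite expr0 fact0 mul1r (big_pred1 finset.set0) ?big_set0 // => u.
  exact: cards_eq0.
suff step : l.+1%:R * \sum_(u : {set 'I_d} | #|u| == l.+1) \prod_(j in u) a j
    <= (\sum_j a j) * \sum_(u : {set 'I_d} | #|u| == l) \prod_(j in u) a j.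
  rewrite factS natrM exprS -mulrA mulrCA.
  apply: (le_trans (ler_wpM2l (ler0n _ _) step)).
  by rewrite mulrCA ler_wpM2l // sumr_ge0.
rewrite mulr_sumr (eq_bigr (fun u : {set 'I_d} =>
    \sum_(j in u) \prod_(j in u) a j)); last first.
  by move=> u /eqP ul; rewrite sumr_const ul mulr_natl.
rewrite (exchange_big_dep xpredT) //= mulr_suml; apply: ler_sum => j _.
rewrite (reindex_onto (fun u => j |: u)%SET (fun v => v :\ j)%SET); last first.
  by move=> u /andP[_ ju]; exact: finset.setD1K.
rewrite mulr_sumr big_mkcond [leRHS]big_mkcond /=; apply: ler_sum => u _.
have P0 (v : {set 'I_d}) : 0 <= \prod_(i in v) a i by exact: prodr_ge0.
case: ifPn => [/andP[/andP[/eqP ul _] /eqP uj]|_]; last first.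
  by case: ifP => // _; rewrite mulr_ge0.
(* The side condition [uj] left by the reindexing says that removing [j] from [j |: u] gives back
   [u], so [j] is not in [u]. *)
have ju : j \notin u by rewrite -uj !inE eqxx.
by move: ul; rewrite cardsU1 ju add1n => -[->]; rewrite eqxx big_setU1.
Qed.

(** Distributivity: the functions with support exactly [u] are the choices of one index other than
    [o] for each [j] in [u]. In the application [o] is the index of the frequency zero. *)
Lemma sum_by_support (R : realType) d m (w : 'I_d -> 'I_m -> R) (o : 'I_m)
    (G : nat -> R) :
  \sum_(a : {ffun 'I_d -> 'I_m})
     G #|[set j | a j != o]%SET| * \prod_(j | a j != o) w j (a j) =
  \sum_(u : {set 'I_d}) G #|u| * \prod_(j in u) \sum_(i | i != o) w j i.
Proof.
rewrite (partition_big (fun a : {ffun 'I_d -> 'I_m} =>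
  [set j | a j != o]%SET) xpredT) //=; apply: eq_bigr => u _.
rewrite (big_distr_big o) mulr_sumr; apply: eq_big => [a|a /eqP <-].
  apply/eqP/pffun_onP => [<-|[sub im]].
    split; first by apply/fintype.subsetP => j; rewrite !inE.
    by move=> y /mapP[j]; rewrite mem_enum inE => ? ->.
  apply/setP => j; rewrite !inE; apply/idP/idP => [h|ju].
    by move/fintype.subsetP: sub; apply; rewrite inE.
  by have := im (a j); apply; apply: map_f; rewrite mem_enum.
by congr (_ * _); apply: eq_bigl => j; rewrite inE.
Qed.

(** After grouping the supports by cardinality, [elementary_sum_le] turns each inner sum into a
    power and supplies the factor 1/l! on which both summability proofs rely. *)
Lemma support_sum_le (R : realType) d m (w : 'I_d -> 'I_m -> R) (o : 'I_m)
    (G : nat -> R) :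
  (forall l, 0 <= G l) -> (forall j i, 0 <= w j i) ->
  \sum_(a : {ffun 'I_d -> 'I_m})
     G #|[set j | a j != o]%SET| * \prod_(j | a j != o) w j (a j) <=
  \sum_(l < d.+1) G l / l`!%:R * (\sum_j \sum_(i | i != o) w j i) ^+ l.
Proof.
move=> G0 w0; rewrite sum_by_support.
have cu (u : {set 'I_d}) : (#|u| < d.+1)%N.
  by rewrite ltnS (leq_trans (max_card _)) ?card_ord.
rewrite (partition_big (fun u => Ordinal (cu u)) xpredT) //=.
apply: ler_sum => l _; rewrite (eq_bigl (fun u : {set 'I_d} => #|u| == l)) //.
under eq_bigr => u /eqP -> do [].
rewrite -mulr_sumr -mulrA ler_wpM2l // mulrC ler_pdivlMr ?ltr0n ?fact_gt0 //.
by rewrite mulrC; apply: elementary_sum_le => j; exact: sumr_ge0.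
Qed.

Lemma ler_sum_uniq_subset (R : realType) (T : eqType) (s t : seq T) (f :
  T -> R) :
  uniq s -> uniq t -> {subset s <= t} -> (forall x, 0 <= f x) ->
  \sum_(x <- s) f x <= \sum_(x <- t) f x.
Proof.
move=> us ut st f0.
have /(perm_big _)/= -> : perm_eq s [seq x <- t | x \in s].
  apply: uniq_perm => //; first exact: filter_uniq.
  by move=> x; rewrite mem_filter; case: (boolP (x \in s)) => //= /st ->.
by rewrite big_filter big_mkcond; apply: ler_sum => x _; case: ifP.
Qed.

(** * Supports and boxes of frequencies *)

Section Supp.
Variables (R : realType) (d : nat).
Implicit Type k : freq d.

Lemma suppE k : supp k = [fset nat_of_ord j | j in [set j | k j != 0]%SET]%fset.
Proof.
by apply/fsetP => n; apply/imfsetP/imfsetP => -[j /= jk ->]; exists j => //=;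
  rewrite !inE in jk *.
Qed.

Lemma card_supp k : #|` supp k|%fset = #|[set j | k j != 0]%SET|.
Proof.
rewrite suppE card_imfset /=; last exact: ord_inj.
by rewrite cardE.
Qed.

Lemma prod_supp k (g : nat -> R) :
  \prod_(j <- supp k) g j = \prod_(j < d | k j != 0) g j.
Proof.
rewrite suppE big_imfset /=; last by move=> i j _ _; exact: ord_inj.
by rewrite big_enum; apply: eq_bigl => j; rewrite inE.
Qed.

(** Digits in {0, ..., 2m} shifted by m make a sum over the box a sum over a finite function type,
    to which [support_sum_le] applies; the entry 0 is the digit m. *)
Definition box m : seq (freq d) :=
  [seq [ffun j => (a j : nat)%:Z - m%:Z] | a : {ffun 'I_d -> 'I_(m.*2).+1}].

Lemma mem_box m k : (k \in box m) = [forall j, `|k j| <= m%:Z].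
Proof.
apply/mapP/forallP => [[a _ ->] j|h].
  by rewrite ffunE; move: (nat_of_ord (a j)) (ltn_ord (a j)) => n;
    rewrite -addnn; lia.
exists [ffun j => inord (absz (k j + m%:Z))]; first by rewrite mem_enum.
have hj j : (absz (k j + m%:Z)%R < (m.*2).+1)%N.
  by have := h j; move: (k j) => n; rewrite -addnn; lia.
by apply/ffunP => j; rewrite !ffunE inordK //; have := h j; move: (k j) => n;
  lia.
Qed.

Lemma box_uniq m : uniq (box m).
Proof.
rewrite map_inj_uniq ?enum_uniq // => a b /ffunP h; apply/ffunP => j.
by apply: val_inj => /=; have := h j; rewrite !ffunE; lia.
Qed.

Lemma sub_box (F : seq (freq d)) : exists m, {subset F <= box m}.
Proof.
elim: F => [|k F [m Fm]]; first by exists 0%N.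
have [M kM] : exists M, forall j, (absz (k j) <= M)%N.
  by exists (\max_j absz (k j))%N => j; exact: leq_bigmax.
exists (maxn m M) => l; rewrite inE mem_box => /orP[/eqP ->|].
  by apply/forallP => j; have := kM j; lia.
move=> /Fm; rewrite mem_box => /forallP h; apply/forallP => j.
by have := h j; lia.
Qed.

(* The reciprocal of [korobov_r], with value [0] where the latter is [+oo]. *)
Definition rho (alpha : R) (gamma : {fset nat} -> R) k :=
  gamma (supp k) / \prod_(j < d | k j != 0) `|(k j)%:~R| `^ alpha.

End Supp.

Section PowerSums.
Variable R : realType.

Lemma powR_prod (I : Type) (r : seq I) (P : pred I) (F : I -> R) (x : R) :
  (forall i, 0 <= F i) ->
  (\prod_(i <- r | P i) F i) `^ x = \prod_(i <- r | P i) F i `^ x.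
Proof.
move=> F0; suff [] : (\prod_(i <- r | P i) F i) `^ x = \prod_(i <- r | P i)
  F i `^ x
  /\ 0 <= \prod_(i <- r | P i) F i by [].
elim/big_rec2: _ => [|i y1 y2 _ [<- y0]]; first by rewrite powR1.
by rewrite powRM // mulr_ge0.
Qed.

Definition partial_zeta (s : R) m := \sum_(1 <= n < m.+1) n%:R `^ (- s).

Lemma partial_zeta_ge0 s m : 0 <= partial_zeta s m.
Proof. by apply: sumr_ge0 => *; exact: powR_ge0. Qed.

Lemma sum_two_sided (F : nat -> R) m :
  \sum_(i < (m.*2).+1 | i != inord m) F `|i%:Z - m%:Z|%N =
  2 * \sum_(1 <= n < m.+1) F n.
Proof.
pose H i := F (absz (i%:Z - m%:Z)).
rewrite (eq_bigl (fun i : 'I_(m.*2).+1 => (i : nat) != m)); last first.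
  by move=> i /=; rewrite -val_eqE /= inordK // ltnS -addnn leq_addr.
(* Split at i = m, whose term is excluded: the left half read backwards and the right half are both
   the sum over n = 1, ..., m. *)
rewrite -(big_mkord (fun i => i != m) H) (@big_cat_nat _ _ _ m) //=; last first.
  by rewrite -addnn ltnW // ltnS leq_addr.
rewrite [X in _ + X]big_ltn_cond; last by rewrite ltnS -addnn leq_addr.
rewrite eqxx /= mulr_natl mulr2n; congr (_ + _).
  rewrite big_nat_rev /= big_add1 /= big_nat_cond [RHS]big_nat_cond.
  apply: eq_big => i; first by lia.
  by move=> /andP[hi _]; rewrite /H; congr F; lia.
rewrite -[X in index_iota X _](add1n m) big_addn.
have -> : (m.*2.+1 - m = m.+1)%N by rewrite -addnn; lia.
rewrite big_nat_cond [RHS]big_nat_cond; apply: eq_big => i; first by lia.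
by move=> /andP[hi _]; rewrite /H; congr F; lia.
Qed.
End PowerSums.

(** Product weights are the case [G = 1], so both kinds of weights go through this factorisation
    over the support. *)
Lemma rho_pod (R : realType) (alpha lam : R) gamma (G g : nat -> R) d (k :
  freq d) :
  (forall l, 0 <= G l) -> (forall j, 0 <= g j) ->
  (forall u : {fset nat}, gamma u = G #|` u|%fset * \prod_(j <- u) g j) ->
  rho alpha gamma k `^ lam = G #|[set j | k j != 0]%SET| `^ lam *
    \prod_(j < d | k j != 0) (g j `^ lam * `|(k j)%:~R| `^ (- (alpha * lam))).
Proof.
move=> G0 g0 gE; rewrite /rho gE card_supp prod_supp -mulrA -prodf_div.
have F0 (j : 'I_d) : 0 <= g j / `|(k j)%:~R| `^ alpha by rewrite divr_ge0
  ?powR_ge0.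
rewrite powRM ?prodr_ge0 // powR_prod //; congr (_ * _).
apply: eq_bigr => j _; rewrite powRM ?invr_ge0 ?powR_ge0 //; congr (_ * _).
by rewrite -powRN -powRrM mulNr.
Qed.

(** Enlarging [F] to the whole box adds only non-negative terms and lets the sum factor over
    coordinates; a coordinate in the support then contributes 2 [partial_zeta] times g_j^lam. *)
Lemma rho_sum_le (R : realType) (alpha lam : R) gamma (G g : nat -> R) d m
    (F : seq (freq d)) :
  (forall l, 0 <= G l) -> (forall j, 0 <= g j) ->
  (forall u : {fset nat}, gamma u = G #|` u|%fset * \prod_(j <- u) g j) ->
  uniq F -> {subset F <= box d m} ->
  \sum_(k <- F) rho alpha gamma k `^ lam <=
  \sum_(l < d.+1) G l `^ lam / l`!%:R *
     (2 * partial_zeta (alpha * lam) m * \sum_(j < d) g j `^ lam) ^+ l.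
Proof.
move=> G0 g0 gE uF Fm.
apply: le_trans (ler_sum_uniq_subset uF (box_uniq d m) Fm _) _.
  by move=> k; exact: powR_ge0.
pose w (j : 'I_d) (i : 'I_(m.*2).+1) :=
  g j `^ lam * `|i%:Z - m%:Z|%:~R `^ (- (alpha * lam)).
have w0 j i : 0 <= w j i by rewrite mulr_ge0 ?powR_ge0.
have G0' l : 0 <= G l `^ lam by exact: powR_ge0.
rewrite /box big_map big_enum /=.
have := support_sum_le (inord m) G0' w0.
have -> : \sum_j \sum_(i | i != inord m) w j i =
  2 * partial_zeta (alpha * lam) m * \sum_(j < d) g j `^ lam.
  rewrite mulr_sumr; apply: eq_bigr => j _; rewrite -mulr_sumr mulrC.
  congr (_ * _); rewrite -sum_two_sided; apply: eq_bigr => i _.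
  by congr (_ `^ _); rewrite natr_absz.
move=> /(le_trans _); apply; apply: ler_sum => a _;
  rewrite (rho_pod _ _ _ G0 g0 gE).
have aE j : ([ffun j => (a j : nat)%:Z - m%:Z] j != 0) = (a j != inord m).
  rewrite ffunE subr_eq0 -val_eqE /= inordK // ltnS -addnn leq_addr //.
under eq_finset do rewrite aE.
rewrite (eq_bigl _ _ aE) le_eqVlt; apply/orP; left; apply/eqP.
by congr (_ * _); apply: eq_bigr => j _; rewrite /w ffunE intr_norm.
Qed.

(** * Bounds on the power sums that are uniform in the dimension *)

Section Summability.
Variable R : realType.

Lemma sum_expr_le (q : R) n : 0 <= q < 1 -> \sum_(i < n) q ^+ i <= (1 - q)^-1.
Proof.
move=> /andP[q0 q1]; rewrite -div1r ler_pdivlMr ?subr_gt0 // mulrC.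
rewrite -opprB mulNr -subrX1 opprB lerBlDr lerDl; exact: exprn_ge0.
Qed.

(** Dyadic condensation: the range is enlarged to n < 2^m, and the block 2^i <= n < 2^(i+1)
    contributes at most 2^i (2^i)^(-s) = q^i, a term of a geometric series. *)
Lemma partial_zeta_bounded (s : R) m :
  1 < s -> partial_zeta s m <= (1 - 2 `^ (1 - s))^-1.
Proof.
move=> s1; set q := 2 `^ (1 - s).
have q1 : 0 <= q < 1.
  by rewrite powR_ge0 /q /powR gt_eqF // expR_lt1 pmulr_llt0 ?ln_gt0 ?subr_lt0
    ?ltr1n.
apply: le_trans (sum_expr_le m q1).
apply: (@le_trans _ _ (partial_zeta s (2 ^ m).-1)).
  rewrite /partial_zeta [leRHS](@big_cat_nat _ _ _ m.+1) //=; last first.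
    by rewrite prednK ?expn_gt0 // ltn_expl.
  by rewrite lerDl; apply: sumr_ge0 => *; exact: powR_ge0.
elim: m => [|m IH]; first by rewrite /partial_zeta big_geq // big_ord0.
rewrite big_ord_recr /= /partial_zeta prednK ?expn_gt0 //.
rewrite (@big_cat_nat _ _ _ (2 ^ m)) //=; last 2 first.
  by rewrite expn_gt0.
  by rewrite leq_exp2l.
apply: lerD; first by move: IH; rewrite /partial_zeta prednK ?expn_gt0.
apply: (@le_trans _ _ (\sum_(2 ^ m <= i < 2 ^ m.+1) (2 ^ m)%:R `^ (- s))).
  rewrite big_nat_cond [leRHS]big_nat_cond; apply: ler_sum =>
    i /andP[/andP[mi _] _].
  have p0 : (0 : R) < (2 ^ m)%:R by rewrite ltr0n expn_gt0.
  have i0 : (0 : R) < i%:R by apply: lt_le_trans p0 _; rewrite ler_nat.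
  rewrite !powRN lef_pV2 ?posrE ?powR_gt0 //.
  by apply: ge0_ler_powR; rewrite ?nnegrE ?ler0n ?ler_nat //; lra.
rewrite sumr_const_nat expnS mul2n -addnn addnK -[leLHS]mulr_natl natrX /q.
rewrite -(powR_mulrn m (powR_ge0 2 _)) -powR_mulrn // -!powRrM -powRD;
  last first.
  by rewrite pnatr_eq0 implybT.
by rewrite le_eqVlt; apply/orP; left; apply/eqP; congr (_ `^ _); ring.
Qed.

Lemma partial_sum_le (u : nat -> R) n : (forall i, 0 <= u i) ->
  ((\sum_(i < n) u i)%:E <= \sum_(0 <= i <oo) (u i)%:E)%E.
Proof.
move=> u0; rewrite -(big_mkord xpredT) -sumEFin; apply: nneseries_lim_ge => //.
by move=> i _; rewrite lee_fin.
Qed.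

(** Finite partial sums stand in for the infinite sum. That one [C] serves every [d] is what makes
    the final complexity bound independent of the dimension. *)
Definition rho_summable (alpha lam : R) gamma C :=
  forall d (F : seq (freq d)), uniq F ->
    \sum_(k <- F) rho alpha gamma k `^ lam <= C.

(** With [G = 1] the bound of [rho_sum_le] is a partial sum of the exponential series. *)
Lemma product_rho_summable (alpha lam : R) gamma (g : nat -> R) :
  0 < alpha -> alpha^-1 < lam -> (forall j, 0 <= g j) ->
  product_weights gamma g -> (\sum_(0 <= j <oo) (g j `^ lam)%:E < +oo)%E ->
  exists C, rho_summable alpha lam gamma C.
Proof.
move=> alpha0 alam g0 gE Sfin.
set S := (\sum_(0 <= j <oo) (g j `^ lam)%:E)%E in Sfin.
have S0 : (0 <= S)%E by apply: nneseries_ge0 => *; rewrite lee_fin powR_ge0.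
have SE : (fine S)%:E = S by rewrite fineK // ge0_fin_numE.
have al1 : 1 < alpha * lam by rewrite mulrC -ltr_pdivrMr // mul1r.
pose Z := (1 - 2 `^ (1 - alpha * lam))^-1 : R.
exists (expR (2 * Z * fine S)) => d F uF.
have [m Fm] := sub_box F.
have gE' u : gamma u = (fun=> 1) #|` u|%fset * \prod_(j <- u)
  g j by rewrite mul1r.
apply: (le_trans (rho_sum_le alpha lam (fun=> ler01) g0 gE' uF Fm)).
set x := 2 * _ * _; have x0 : 0 <= x.
  by rewrite !mulr_ge0 ?partial_zeta_ge0 ?sumr_ge0 // => *; exact: powR_ge0.
apply: (@le_trans _ _ (expR x)); last first.
  rewrite ler_expR ler_pM ?mulr_ge0 ?partial_zeta_ge0 ?sumr_ge0 //.
  - by move=> *; exact: powR_ge0.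
  - by rewrite ler_wpM2l // partial_zeta_bounded.
  - by rewrite -lee_fin SE; apply: partial_sum_le => i; exact: powR_ge0.
have -> : \sum_(l < d.+1) 1 `^ lam / l`!%:R * x ^+ l = series (exp_coeff x)
  d.+1.
  rewrite /series /= big_mkord; apply: eq_bigr => l _.
  by rewrite powR1 div1r exp_coeffE.
apply: nondecreasing_cvgn_le; last exact: is_cvg_series_exp_coeff.
apply/nondecreasing_seqP => n; rewrite /series /= big_nat_recr //= lerDl.
exact: exp_coeff_ge0.
Qed.

(** The growth condition on [Gam] cancels the factor 1/l! up to the constant c^lam, which leaves a
    geometric series of ratio at most [fine Q] < 1. *)
Lemma pod_rho_summable (alpha lam c : R) gamma (Gam g : nat -> R) :
  0 < alpha -> alpha^-1 < lam -> gamma fset0 = 1 -> 0 < c ->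
  (forall j, 0 <= g j) -> (forall l, 0 <= Gam l) -> pod_weights gamma Gam g ->
  (2%:E * zeta (alpha * lam) * \sum_(0 <= j <oo) (g j `^ lam)%:E < 1)%E ->
  (forall l : nat, (0 < l)%N -> Gam l <= c * (l`!)%:R `^ lam^-1) ->
  exists C, rho_summable alpha lam gamma C.
Proof.
move=> alpha0 alam gam0 c0 g0 Gam0 gE; set S := (\sum_(0 <= j <oo)
  (g j `^ lam)%:E)%E.
have lam0 : 0 < lam by apply: lt_trans alam; rewrite invr_gt0.
have Gam00 : Gam 0%N = 1 by have := gE fset0;
  rewrite gam0 cardfs0 big_nil mulr1.
move=> Qlt Gamle.
have S0 : (0 <= S)%E by apply: nneseries_ge0 => *; rewrite lee_fin powR_ge0.
have Z0 : (0 <= zeta (alpha * lam))%E.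
  by apply: nneseries_ge0 => *; rewrite lee_fin powR_ge0.
set Q := (_ * S)%E in Qlt.
have Q0 : (0 <= Q)%E by rewrite !mule_ge0.
have QE : (fine Q)%:E = Q by rewrite fineK // ge0_fin_numE // (lt_trans Qlt)
  ?ltry.
(* The growth condition starts at l = 1; for l = 0 the value is 1 because the empty set has weight
   1, hence the maximum. *)
have Gl l : Gam l `^ lam / l`!%:R <= Num.max 1 (c `^ lam).
  have f0 : (0 : R) < l`!%:R by rewrite ltr0n fact_gt0.
  rewrite le_max; case: l f0 => [|l] f0.
    by rewrite Gam00 powR1 fact0 divr1 lexx.
  apply/orP; right; rewrite ler_pdivrMr //.
  have -> : c `^ lam * l.+1`!%:R = (c * l.+1`!%:R `^ lam^-1) `^ lam.
    by rewrite powRM ?powR_ge0 1?ltW // -powRrM mulVf ?gt_eqF // powRr1 // ltW.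
  apply: (ge0_ler_powR (ltW lam0)); rewrite ?nnegrE //; last exact: Gamle.
  by rewrite mulr_ge0 ?powR_ge0 // ltW.
exists (Num.max 1 (c `^ lam) * (1 - fine Q)^-1) => d F uF.
have [m Fm] := sub_box F.
apply: (le_trans (rho_sum_le alpha lam Gam0 g0 gE uF Fm)).
set x := 2 * _ * _; have x0 : 0 <= x.
  by rewrite !mulr_ge0 ?partial_zeta_ge0 ?sumr_ge0 // => *; exact: powR_ge0.
have xQ : x <= fine Q.
  rewrite -lee_fin QE /x EFinM; apply: lee_pmul.
  - by rewrite lee_fin mulr_ge0 ?partial_zeta_ge0.
  - by rewrite lee_fin sumr_ge0 // => *; exact: powR_ge0.
  - rewrite EFinM lee_wpmul2l ?lee_fin // -sumEFin.
    by apply: nneseries_lim_ge => *; rewrite lee_fin powR_ge0.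
  - by apply: partial_sum_le => i; exact: powR_ge0.
apply: (@le_trans _ _ (\sum_(l < d.+1) Num.max 1 (c `^ lam) * (fine Q) ^+ l)).
  apply: ler_sum => l _; apply: ler_pM => //; rewrite ?exprn_ge0 //.
    by rewrite divr_ge0 ?powR_ge0.
  by apply: lerXn2r; rewrite ?nnegrE // (le_trans x0).
rewrite -mulr_sumr ler_wpM2l ?le_max ?ler01 // sum_expr_le //.
by rewrite fine_ge0 //= -lte_fin QE.
Qed.

End Summability.

(** * Lattice rules *)

Definition ldot d N (l : freq d) (z : {ffun 'I_d -> 'I_N}) : int :=
  \sum_j l j * (z j : nat)%:Z.

(* The residue of [l . z] is [c + l_j z_j] with [c] independent of [z_j]; when it
   is a multiple of [N], its quotient by [N] lies within [|l_j|] of that of [c]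
   and determines [z_j]. *)
Lemma card_dual_lattice d N S (l : freq d) (j : 'I_d) :
  (0 < N)%N -> l j != 0 -> (absz (l j) <= S)%N ->
  (#|[set z : {ffun 'I_d -> 'I_N} | (N %| ldot l z)%Z]%SET| * N <= S.+1 * N ^
    d)%N.
Proof.
move=> N0 lj0 ljS; set A := [set z | _]%SET.
pose c (z : {ffun 'I_d -> 'I_N}) := \sum_(i | i != j) l i * (z i : nat)%:Z.
have ldotE z : ldot l z = l j * (z j : nat)%:Z + c z by rewrite /ldot (bigD1 j).
(* An injection on pairs [(z, t)] with [z] in [A]: [t] overwrites z_j, and the quotient difference
   allows z_j to be recovered. Its sign is that of l_j unless it vanishes, so the absolute value
   loses nothing. *)
pose f (zt : {ffun 'I_d -> 'I_N} * 'I_N) :=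
  (inord (absz ((ldot l zt.1 %/ N)%Z - (c zt.1 %/ N)%Z)) : 'I_S.+1,
   [ffun i => if i == j then zt.2 else zt.1 i]).
have fS z : (absz ((ldot l z %/ N)%Z - (c z %/ N)%Z) <= absz (l j))%N.
  have := divz_eq (ldot l z) N; have := divz_eq (c z) N; rewrite ldotE.
  have := ltz_pmod (c z) (d := N%:Z) N0.
  have := ltz_pmod (l j * (z j : nat)%:Z + c z) (d := N%:Z) N0.
  have := @modz_ge0 (c z) N%:Z.
  have := @modz_ge0 (l j * (z j : nat)%:Z + c z) N%:Z.
  move: (_ %/ _)%Z (_ %/ _)%Z (_ %% _)%Z (_ %% _)%Z => q1 q2 r1 r2.
  move: (l j) (c z) (nat_of_ord (z j)) (ltn_ord (z j)) => lj cz n zN.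
  nia.
have -> : (#|A| * N)%N = #|finset.setX A [set: 'I_N]%SET|.
  by rewrite cardsX cardsT card_ord.
rewrite -[S.+1]card_ord.
have -> : (N ^ d)%N = #|{ffun 'I_d -> 'I_N}| by rewrite card_ffun !card_ord.
rewrite -card_prod -(@card_in_imset _ _ f); first exact: max_card.
move=> [z t] [z' t']; rewrite !inE /= !andbT => zA zA' [].
move=> /(congr1 (@nat_of_ord _)); rewrite /= !inordK ?ltnS ?(leq_trans (fS _))
  //.
move=> fzz /ffunP h.
have tt : t = t' by have := h j; rewrite !ffunE eqxx.
have zz i : i != j -> z i = z' i.
  by move=> ij; have := h i; rewrite !ffunE (negbTE ij).
have cc : c z = c z' by apply: eq_bigr => i /zz ->.
have zj : z j = z' j.
  apply: val_inj => /=; move: zA zA' fzz; rewrite !ldotE -cc.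
  move=> /divzK zA /divzK zA'; move: zA zA'.
  have := divz_eq (c z) N; have := ltz_pmod (c z) (d := N%:Z) N0.
  have := @modz_ge0 (c z) N%:Z.
  move: (_ %/ _)%Z (_ %/ _)%Z (_ %/ _)%Z (_ %% _)%Z => q1 q2 q3 r.
  move: (l j) (c z) lj0 (nat_of_ord (z j)) (nat_of_ord (z' j)) =>
    lj cz lj0 n n'.
  move=> r0 rN cE aE aE' absE.
  have : lj * n%:Z = lj * n'%:Z by nia.
  by move/(mulfI lj0); case.
congr (_, _) => //; apply/ffunP => i.
by have [->|/zz] := eqVneq i j.
Qed.

(** * Averaging the aliasing term over generating vectors *)

Section GoodGenerator.
Variables (R : realType) (d N S : nat) (A : seq (freq d)).
Variables (rho2 w : freq d -> R) (B C tau : R).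

(** When [N] divides [ldot (h - k) z], the characters of [h] and [k] agree at all lattice points, so
    the rule cannot tell them apart. *)
Definition aliasing (z : {ffun 'I_d -> 'I_N}) (F : seq (freq d)) : R :=
  \sum_(h <- F) (\sum_(k <- A | k != h) (N %| ldot (h - k) z)%Z%:R) * rho2 h.

Hypothesis N0 : (0 < N)%N.
Hypothesis AS : forall (k : freq d) j, k \in A -> (absz (k j) * 2 <= S)%N.
Hypothesis rho2_ge0 : forall h, 0 <= rho2 h.
Hypothesis w_ge0 : forall h, 0 <= w h.
Hypothesis B_ge0 : 0 <= B.
Hypothesis tau_ge0 : 0 <= tau.
Hypothesis rho2_w : forall h, rho2 h <= B * w h.
Hypothesis rho2_tau : forall (h : freq d) j, (S < absz (h j)
  * 2)%N -> rho2 h <= tau * w h.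
Hypothesis sum_w : forall F, uniq F -> \sum_(h <- F) w h <= C.

Let Nd : R := (N ^ d)%:R.

(** If some non-zero entry of h - k is at most S, [card_dual_lattice] bounds the share of bad [z] by
    (S+1)/N. Otherwise h and k differ by more than S in some entry j; since |k_j| <= S/2, this
    forces |h_j| > S/2, and [rho2_tau] applies. *)
Lemma pair_aliasing_le h k : k \in A -> k != h ->
  \sum_(z : {ffun 'I_d -> 'I_N}) (N %| ldot (h - k) z)%Z%:R * rho2 h <=
  Nd * ((S.+1%:R / N%:R * B + tau) * w h).
Proof.
move=> kA kh; rewrite -mulr_suml.
have -> : \sum_(z : {ffun 'I_d -> 'I_N}) (N %| ldot (h - k) z)%Z%:R =
    #|[set z : {ffun 'I_d -> 'I_N} | (N %| ldot (h - k) z)%Z]%SET|%:R :> R.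
  rewrite -sum1dep_card natr_sum [RHS]big_mkcond /=.
  by apply: eq_bigr => z _; case: (_ %| _)%Z.
have Nr : 0 < N%:R :> R by rewrite ltr0n.
rewrite mulrDl mulrDr.
have [/existsP[j /andP[lj0 ljS]]|] :=
    boolP [exists j, ((h - k) j != 0) && (absz ((h - k)%R j) <= S)%N].
  apply: ler_wpDr; first by rewrite !mulr_ge0 ?ler0n.
  rewrite -(mulrA (S.+1%:R / _)) (mulrA Nd); apply: ler_pM => //.
  rewrite mulrA ler_pdivlMr // /Nd -!natrM ler_nat [leqRHS]mulnC.
  exact: card_dual_lattice lj0 ljS.
rewrite negb_exists => /forallP hk; apply: ler_wpDl.
  by rewrite !mulr_ge0 ?ler0n ?divr_ge0.
have [j hj] : exists j, h j != k j.
  apply/existsP; apply: contraNT kh; rewrite negb_exists => /forallP hk'.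
  by apply/eqP/ffunP => j; have := hk' j; rewrite negbK => /eqP.
apply: ler_pM => //.
  by rewrite /Nd ler_nat (leq_trans (max_card _)) // card_ffun !card_ord.
apply: (rho2_tau (j := j)); have := hk j; have := AS j kA.
rewrite !ffunE subr_eq0 hj /=; move: (h j) (k j) => x y; lia.
Qed.

Lemma aliasing_average F : uniq F ->
  \sum_z aliasing z F <= Nd * ((size A)%:R * (C * (S.+1%:R / N%:R * B + tau))).
Proof.
move=> uF; rewrite /aliasing exchange_big /=.
have M0 : 0 <= S.+1%:R / N%:R * B + tau by rewrite addr_ge0 ?mulr_ge0 ?invr_ge0
  ?ler0n.
apply: (@le_trans _ _ (\sum_(h <- F)
    Nd * ((size A)%:R * (w h * (S.+1%:R / N%:R * B + tau))))); last first.
  by rewrite -mulr_sumr -mulr_sumr -mulr_suml !ler_wpM2l ?ler0n // ler_wpM2r //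
    sum_w.
apply: ler_sum => h _.
under eq_bigr do rewrite mulr_suml.
rewrite exchange_big /= mulrCA.
set M := _ + _; have -> : (size A)%:R * (Nd * (w h * M)) =
    \sum_(k <- A) Nd * (M * w h).
  by rewrite big_const_seq count_predT iter_addr_0 mulr_natl [w h * M]mulrC.
rewrite big_seq_cond big_mkcond [leRHS]big_seq_cond [leRHS]big_mkcond.
apply: ler_sum => k _; case: ifP => [/andP[kA kh]|_].
  by rewrite kA; exact: pair_aliasing_le.
by case: ifP => // _; rewrite !mulr_ge0 ?ler0n.
Qed.

(* Were every [z] bad, the union of the witnesses would violate the average. *)
Lemma good_generator : exists z, forall F, uniq F ->
  aliasing z F <= (size A)%:R * (C * (S.+1%:R / N%:R * B + tau)).
Proof.
apply/not_existsP => bad.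
set E := _ * _ in bad.
have /choice[Fz FzP] : forall z, exists F, uniq F /\ E < aliasing z F.
  move=> z; have /existsNP[F /not_implyP[uF /negP]] := bad z.
  by rewrite -ltNge => ?; exists F.
pose F := undup (flatten [seq Fz z | z <- enum {ffun 'I_d -> 'I_N}]).
have uF : uniq F by exact: undup_uniq.
have := aliasing_average uF; apply/negP; rewrite -ltNge.
have -> : Nd * E = \sum_(z : {ffun 'I_d -> 'I_N}) E.
  by rewrite sumr_const card_ffun !card_ord mulr_natl.
have z0 : {ffun 'I_d -> 'I_N} := [ffun=> Ordinal N0].
apply: ltr_sum => [|z _]; first by apply/hasP; exists z0;
  rewrite ?mem_index_enum.
have [uz Ez] := FzP z; apply: (lt_le_trans Ez).
apply: ler_sum_uniq_subset => // [h hF|h].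
  rewrite mem_undup; apply/flattenP; exists (Fz z) => //.
  by apply: map_f; rewrite mem_enum.
by rewrite mulr_ge0 // sumr_ge0.
Qed.

End GoodGenerator.

(** * Complex exponentials and characters *)

Section Characters.
Variable R : realType.
Implicit Types t : R.

Lemma normc_sum (I : Type) (r : seq I) (P : pred I) (F : I -> R[i]) :
  normc (\sum_(i <- r | P i) F i) <= \sum_(i <- r | P i) normc (F i).
Proof.
elim/big_rec2: _ => [|i x y _ xy]; first by rewrite Normc.normc0.
by rewrite (le_trans (le_normcD _ _)) // lerD2l.
Qed.

Lemma normc_ge0 (z : R[i]) : 0 <= normc z.
Proof. by case: z => a b; exact: sqrtr_ge0. Qed.

Lemma normc_bool (b : bool) : normc (b%:R : R[i]) = b%:R.
Proof. by case: b; rewrite ?Normc.normc1 ?Normc.normc0. Qed.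

Lemma natrC (m : nat) : (m%:R : R[i]) = (m%:R +i* 0)%C.
Proof.
elim: m => // m IH; rewrite -addn1 !natrD IH; apply/eqP.
by rewrite eq_complex /= addr0 !eqxx.
Qed.

Lemma normc_nat (m : nat) : normc (m%:R : R[i]) = m%:R.
Proof. by rewrite natrC /= expr0n /= addr0 sqrtr_sqr ger0_norm. Qed.

Lemma expiD : {morph @expi R : x y / x + y >-> x * y}.
Proof.
by move=> x y; apply/eqP; rewrite eq_complex /= cosD sinD; apply/andP; split;
  apply/eqP; ring.
Qed.

Lemma expi0 : expi 0 = 1 :> R[i].
Proof. by rewrite /expi cos0 sin0. Qed.

Lemma normc_expi t : normc (expi t) = 1.
Proof. by rewrite /= cos2Dsin2 sqrtr1. Qed.

Lemma expiN t : expi (- t) * expi t = 1.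
Proof. by rewrite -expiD addNr expi0. Qed.

Lemma expiMn t n : expi (t *+ n) = expi t ^+ n.
Proof. by elim: n => [|n IH]; rewrite ?expi0 // mulrS exprS expiD IH. Qed.

Lemma expi_2pi_int (n : int) : expi (2 * pi * n%:~R) = 1 :> R[i].
Proof.
have e1 : expi (2 * pi) = 1 :> R[i].
  by rewrite /expi mulr_natl cos2pi mulr2n sinD cospi sinpi !mul0r mulr0 addr0.
have nat_case m : expi (2 * pi * m%:R) = 1 :> R[i].
  by rewrite mulr_natr expiMn e1 expr1n.
case: n => n; first exact: nat_case.
by have := expiN (2 * pi * n.+1%:R); rewrite nat_case mulr1 -mulrN NegzE mulrNz.
Qed.

(** The symmetry t -> 1 - t reduces the claim to t <= 1/2, where cos (2 pi t) decreases. *)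
Lemma cos_2pi_le delta t : 0 <= delta -> delta <= t <= 1 - delta ->
  cos (2 * pi * t) <= cos (2 * pi * delta).
Proof.
move=> d0 /andP[dt td].
have p0 := @pi_ge0 R.
wlog t2 : t dt td / t <= 2^-1.
  move=> H; have [|t2] := lerP t 2^-1; first exact: H.
  have -> : cos (2 * pi * t) = cos (2 * pi * (1 - t)).
    rewrite -[RHS]cosN -(cosD2pi (- _)); congr cos; rewrite -mulr_natl; ring.
  by apply: H; lra.
have itv (x : R) : 0 <= x <= 2^-1 -> 2 * pi * x \in `[0, pi]%R.
  rewrite in_itv /= => /andP[x0 x2].
  rewrite mulr_ge0 ?mulr_ge0 //=.
  have -> : 2 * pi * x = pi * (2 * x) by ring.
  apply: ler_piMr => //; lra.
have ht : 0 <= t <= 2^-1 by apply/andP; split => //; lra.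
have hd : 0 <= delta <= 2^-1 by apply/andP; split => //; lra.
by rewrite leNgt ltr_cos ?itv // -leNgt ler_wpM2l // mulr_ge0.
Qed.

Lemma cos_2pi_lt1 t : 0 < t < 1 -> cos (2 * pi * t) < 1.
Proof.
move=> /andP[t0 t1]; pose delta := Num.min t (1 - t).
have d0 : 0 < delta by rewrite lt_min t0 subr_gt0.
have dt : delta <= t <= 1 - delta.
  by rewrite ge_min lexx /= lerBrDl -lerBrDr ge_min lexx orbT.
apply: (le_lt_trans (cos_2pi_le (ltW d0) dt)).
have p0 := @pi_gt0 R.
have d2 : 2 * delta <= 1 by have /andP[] := dt; lra.
rewrite -[ltRHS]cos0 ltr_cos ?in_itv /= ?lexx ?pi_ge0 ?mulr_gt0 //.
rewrite mulr_ge0 ?mulr_ge0 ?(ltW p0) ?(ltW d0) //=.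
have -> : 2 * pi * delta = pi * (2 * delta) by ring.
by rewrite ler_piMr // ltW.
Qed.
End Characters.

Section Trig.
Variables (R : realType) (d : nat).
Implicit Types (k l h : freq d) (x : d.-tuple R).

Definition chi k x : R[i] := expi (2 * pi * dotp k x).

Lemma dotpD k l x : dotp (k + l) x = dotp k x + dotp l x.
Proof.
by rewrite /dotp -big_split; apply: eq_bigr => i _; rewrite ffunE intrD mulrDl.
Qed.

Lemma dotpN k x : dotp (- k) x = - dotp k x.
Proof.
by rewrite /dotp -sumrN; apply: eq_bigr => i _; rewrite ffunE intrN mulNr.
Qed.

Lemma chiD k l x : chi (k + l) x = chi k x * chi l x.
Proof. by rewrite /chi dotpD mulrDr expiD. Qed.

Lemma chiN k x : chi (- k) x = expi (- (2 * pi * dotp k x)).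
Proof. by rewrite /chi dotpN mulrN. Qed.

Lemma normc_chi k x : normc (chi k x) = 1.
Proof. exact: normc_expi. Qed.

End Trig.

(** * The rank-1 lattice rule and its error on trigonometric polynomials *)

Section LatticeRule.
Variables (R : realType) (d N : nat) (z : {ffun 'I_d -> 'I_N}).
Hypothesis N0 : (0 < N)%N.

Definition lattice_point (i : nat) : d.-tuple R :=
  [tuple ((i * z j) %% N)%:R / N%:R | j < d].

Lemma lattice_point_cube i : unit_cube R d (lattice_point i).
Proof.
move=> j; rewrite tnth_mktuple divr_ge0 ?ler0n //=.
by rewrite ler_pdivrMr ?ltr0n // mul1r ler_nat ltnW // ltn_mod.
Qed.

(** Reducing i z_j modulo N changes the phase by a whole number of turns, so along the lattice a
    character runs through the powers of one root of unity. *)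
Lemma chi_lattice_point (l : freq d) i :
  chi l (lattice_point i) = expi (2 * pi * (ldot l z)%:~R / N%:R) ^+ i.
Proof.
rewrite -expiMn /chi /dotp.
have Nr : N%:R != 0 :> R by rewrite pnatr_eq0 -lt0n.
have key : i%:R * ((ldot l z)%:~R / N%:R) =
    \sum_j (l j)%:~R * tnth (lattice_point i) j +
    (\sum_j l j * ((i * z j) %/ N)%N%:Z)%:~R :> R.
  rewrite /ldot !rmorph_sum /= -big_split /= mulr_suml mulr_sumr.
  apply: eq_bigr => j _; rewrite tnth_mktuple !intrM.
  have -> : i%:R * ((l j)%:~R * (z j : nat)%:~R / N%:R) =
    (l j)%:~R * ((i * z j)%N%:R / N%:R) :> R by rewrite natrM; field.
  rewrite {1}(divn_eq (i * z j) N) natrD natrM; field.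
  exact: Nr.
rewrite (_ : 2 * pi * (ldot l z)%:~R / N%:R *+ i =
    2 * pi * (i%:R * ((ldot l z)%:~R / N%:R))); last by rewrite -mulr_natl;
      field.
by rewrite key (mulrDr (2 * pi)) expiD expi_2pi_int mulr1.
Qed.

(** A geometric sum over powers of an N-th root of unity [w]; [w] differs from 1 when N does not
    divide [ldot l z], since its real part is then below 1. *)
Lemma lattice_character_sum (l : freq d) :
  \sum_(i < N) chi l (lattice_point i) = (N %| ldot l z)%Z%:R * N%:R :> R[i].
Proof.
under eq_bigr do rewrite chi_lattice_point.
have Nr : N%:R != 0 :> R by rewrite pnatr_eq0 -lt0n.
have Ng : 0 < N%:R :> R by rewrite ltr0n.
set w := expi _.
have wE : w = expi (2 * pi * ((ldot l z %% N)%Z%:~R / N%:R)).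
  rewrite /w {1}(divz_eq (ldot l z) N) intrD intrM mulrA.
  have -> : 2 * pi * ((ldot l z %/ N)%Z%:~R * N%:~R + (ldot l z %% N)%Z%:~R)
    / N%:R =
     2 * pi * (ldot l z %/ N)%Z%:~R + 2 * pi * ((ldot l z %% N)%Z%:~R / N%:R)
       :> R.
    by field.
  by rewrite expiD expi_2pi_int mul1r mulrA.
have [/eqP Nl|Nl] := boolP (ldot l z %% N == 0)%Z.
  have dv : (N %| ldot l z)%Z by apply/dvdz_mod0P.
  rewrite dv.
  rewrite mul1r (eq_bigr (fun=> 1)) ?sumr_const ?card_ord // => i _.
  by rewrite wE Nl mulr0z mul0r mulr0 expi0 expr1n.
have -> : (N %| ldot l z)%Z = false.
  by apply/negbTE; apply: contra Nl => /dvdz_mod0P ->.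
rewrite mul0r; apply/eqP.
have w1 : w != 1.
  rewrite wE eq_complex negb_and /= lt_eqF //.
  apply: cos_2pi_lt1; rewrite ltr_pdivrMr // mul1r divr_gt0 //=.
    by rewrite -[N%:R]/(N%:Z%:~R) ltr_int ltz_pmod.
  by rewrite ltr0z lt_neqAle eq_sym Nl modz_ge0 // -lt0n.
have : (w - 1) * \sum_(i < N) w ^+ i = 0.
  by rewrite -subrX1 /w -expiMn -[_ *+ N]mulr_natr divfK // expi_2pi_int subrr.
by move/eqP; rewrite mulf_eq0 subr_eq0 (negbTE w1).
Qed.

Variable A : seq (freq d).

Definition lattice_algorithm : algorithm R N d :=
  Algorithm (fun i : 'I_N => lattice_point_cube i)
    (fun y x => \sum_(k <- A)
       N%:R^-1 * (\sum_(i < N) y i * chi (- k) (lattice_point i)) * chi k x).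

End LatticeRule.

(** Cauchy-Schwarz, read off from expanding the non-negative sum of (y_i - X s_i)^2, where X is the
    sum of the s_i y_i. *)
Lemma sqr_sum_prod_le (R : realType) (I : Type) (r : seq I) (s y : I -> R) :
  \sum_(i <- r) s i ^+ 2 <= 1 ->
  (\sum_(i <- r) s i * y i) ^+ 2 <= \sum_(i <- r) y i ^+ 2.
Proof.
move=> s1; set X := \sum_(i <- r) s i * y i.
have : 0 <= \sum_(i <- r) (y i - X * s i) ^+ 2 by apply: sumr_ge0 => *;
  exact: sqr_ge0.
have -> : \sum_(i <- r) (y i - X * s i) ^+ 2 =
    \sum_(i <- r) y i ^+ 2 - X * X *+ 2 + X ^+ 2 * \sum_(i <- r) s i ^+ 2.
  have -> : X * X = \sum_(i <- r) X * (s i * y i) by rewrite -mulr_sumr.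
  rewrite -sumrMnl -sumrN mulr_sumr -!big_split /=.
  by apply: eq_bigr => i _; ring.
have := ler_wpM2l (sqr_ge0 X) s1; lra.
Qed.

Section LatticeError.
Variables (R : realType) (d N : nat) (z : {ffun 'I_d -> 'I_N}).
Hypothesis N0 : (0 < N)%N.
Variables (A F : seq (freq d)) (b : freq d -> R[i]) (rho s : freq d -> R).
Hypothesis uA : uniq A.
Hypothesis rho0 : forall h, 0 <= rho h.
Hypothesis b_le : forall h, normc (b h) <= rho h * s h.
Hypothesis s1 : \sum_(h <- F) s h ^+ 2 <= 1.

Let g (x : d.-tuple R) : R[i] := \sum_(h <- F) b h * chi h x.
Let dual (h k : freq d) : bool := (N %| ldot (h - k) z)%Z.
Let n (h : freq d) : R := \sum_(k <- A | k != h) (dual h k)%:R.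

(** By [lattice_character_sum], the computed coefficient at [k] collects the coefficients of all [h]
    aliased with [k]. *)
Lemma run_lattice_trig x : run (lattice_algorithm R z N0 A) g x =
  \sum_(h <- F) b h * \sum_(k <- A) (dual h k)%:R * chi k x.
Proof.
rewrite /run /=.
under [RHS]eq_bigr do rewrite mulr_sumr.
rewrite [RHS]exchange_big /=; apply: eq_bigr => k _.
under [RHS]eq_bigr do rewrite mulrA.
rewrite -mulr_suml; congr (_ * _).
under eq_bigr do rewrite ffunE /g mulr_suml.
rewrite exchange_big mulr_sumr; apply: eq_bigr => h _ /=.
under eq_bigr do rewrite -mulrA -chiD.
rewrite -mulr_sumr lattice_character_sum //= mulrCA; congr (_ * _).
by rewrite mulrCA mulVf ?mulr1 // pnatr_eq0 -lt0n.
Qed.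

(** For h in A the term k = h reproduces the character exactly, so the error on one character is at
    most v h = [h notin A] + n h. Cauchy-Schwarz against [s] leaves the sum of (rho v)^2, and v^2 <=
    2 [h notin A] + 2 |A| n because n <= |A|. *)
Lemma lattice_error x :
  normc (g x - run (lattice_algorithm R z N0 A) g x) ^+ 2 <=
  2 * \sum_(h <- F | h \notin A) rho h ^+ 2 +
  2 * (size A)%:R * aliasing A (fun h => rho h ^+ 2) z F.
Proof.
rewrite run_lattice_trig /g -sumrB.
have n0 h : 0 <= n h by apply: sumr_ge0.
have nA h : n h <= (size A)%:R.
  rewrite -(count_predT A) -sum1_count natr_sum /n big_mkcond /=.
  by apply: ler_sum => k _; case: ifP => // _; case: (dual _ _).
pose v h := (h \notin A)%:R + n h.
have v0 h : 0 <= v h by rewrite addr_ge0.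
have D_le h : normc (chi h x - \sum_(k <- A) (dual h k)%:R * chi k x) <= v h.
  have nle : normc (\sum_(k <- A | k != h) (dual h k)%:R * chi k x) <= n h.
    apply: le_trans (normc_sum _ _ _) _; apply: ler_sum => k _.
    by rewrite Normc.normcM normc_chi mulr1 normc_bool.
  have [hA|hA] := boolP (h \in A).
    rewrite (bigD1_seq h) //= /dual subrr.
    have -> : ldot 0 z = 0 by rewrite /ldot big1 // => j _; rewrite ffunE mul0r.
    rewrite dvdz0 mul1r opprD addrA subrr sub0r normcN.
    by rewrite /v hA add0r.
  have -> : \sum_(k <- A) (dual h k)%:R * chi k x =
      \sum_(k <- A | k != h) (dual h k)%:R * chi k x :> R[i].
    rewrite [RHS]big_mkcond; apply: eq_big_seq => k kA.
    by case: eqP => // kh; rewrite -kh kA in hA.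
  rewrite (le_trans (le_normcD _ _)) // normcN normc_chi /v hA lerD2l.
  exact: nle.
have err_le : normc (\sum_(h <- F) (b h * chi h x -
      b h * \sum_(k <- A) (dual h k)%:R * chi k x)) <=
    \sum_(h <- F) s h * (rho h * v h).
  apply: le_trans (normc_sum _ _ _) _; apply: ler_sum => h _.
  rewrite -mulrBr Normc.normcM mulrA [s h * _]mulrC.
  by apply: ler_pM => //; exact: normc_ge0.
apply: (@le_trans _ _ (\sum_(h <- F) (rho h * v h) ^+ 2)).
  apply: le_trans (sqr_sum_prod_le _ s1).
  by apply: lerXn2r => //; rewrite nnegrE ?normc_ge0 // (le_trans (normc_ge0 _)
    err_le).
have term h : (rho h * v h) ^+ 2 <=
    2 * ((h \notin A)%:R * rho h ^+ 2) + 2 * ((size A)%:R * (n h * rho h ^+ 2)).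
  have := ler_wpM2r (n0 h) (nA h); have := n0 h; have := rho0 h.
  rewrite exprMn.
  have r2 := sqr_ge0 (rho h) => _ nh nn.
  have : v h ^+ 2 <= 2 * (h \notin A)%:R + 2 * ((size A)%:R * n h).
    by rewrite /v; case: (h \notin A) => /=; have := sqr_ge0 (1 - n h); nra.
  move=> /(ler_wpM2l r2) h2; apply: (le_trans h2).
  by rewrite le_eqVlt; apply/orP; left; apply/eqP; ring.
apply: le_trans (ler_sum _ (fun h _ => term h)) _.
rewrite big_split /= -!mulr_sumr /aliasing mulrA lerD // ler_wpM2l //.
by rewrite [leRHS]big_mkcond /=; apply: ler_sum => h _; case: ifP;
  rewrite ?mul1r ?mul0r.
Qed.
End LatticeError.

(** * Trigonometric integrals over the unit cube *)

Section CubeMeasure.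
Variable R : realType.

(** The summand 1 makes the integrand non-negative, as [integral_uniform] and Tonelli's theorem
    require; the phase [t] will carry the other coordinates. *)
Lemma integral_uniform_cos (t : R) (n : int) :
  (\int[uniform_prob (@ltr01 R)]_x (1 + cos (t + 2 * pi * (n%:~R * x)))%:E =
   (1 + (n == 0)%:R * cos t)%:E)%E.
Proof.
have cf : continuous (fun x : R => 1 + cos (t + 2 * pi * (n%:~R * x))).
  move=> x; apply: cvgD; first exact: cvg_cst.
  apply: (@continuous_comp _ _ _ (fun x : R => t + 2 * pi * (n%:~R * x)) cos);
    last exact: continuous_cos.
  apply: cvgD; first exact: cvg_cst.
  by apply: cvgM; [exact: cvg_cst|apply: cvgM; [exact: cvg_cst|exact: cvg_id]].
rewrite integral_uniform; last 2 first.
- by apply/measurable_EFinP; exact: continuous_measurable_fun.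
- by move=> x; rewrite lee_fin -lerBlDl sub0r; exact: cos_geN1.
rewrite subr0 invr1 mul1e.
have [->|n0] := eqVneq n 0.
  under eq_integral do rewrite mul0r mulr0 addr0.
  by rewrite integral_cst //= lebesgue_measure_itv /= lte01 oppr0 adde0 mule1
    mul1r.
rewrite mul0r addr0.
pose c : R := 2 * pi * n%:~R.
have c0 : c != 0 by rewrite !mulf_neq0 ?intr_eq0 // gt_eqF // pi_gt0.
pose F (x : R) := x + c^-1 * sin (t + c * x).
have dF (x : R) : is_derive x 1 F (1 + cos (t + 2 * pi * (n%:~R * x))).
  rewrite /F; apply: is_derive_eq.
  have -> : 2 * pi * (n%:~R * x) = c * x by rewrite /c mulrA.
  rewrite /GRing.scale /= add0r mul1r mulr1.
  by rewrite mulrCA mulVf // mulr1.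
rewrite (@continuous_FTC2 _ _ F) //.
- rewrite /F mulr1 mulr0 addr0 add0r -EFinB; congr (_%:E).
  have -> : sin (t + c) = sin t.
    have [sc cc] : sin c = 0 /\ cos c = 1.
      by have := expi_2pi_int R n; rewrite /expi -/c => -[-> ->].
    by rewrite sinD sc cc mulr1 mulr0 addr0.
  by rewrite addrK.
- exact: continuous_subspaceT.
- have Fc : continuous F by move=> x;
  apply/differentiable_continuous/derivable1_diffP/ex_derive.
  split.
  + by move=> x _; exact: ex_derive.
  + exact/cvg_at_right_filter/Fc.
  + exact/cvg_at_left_filter/Fc.
- by move=> x _; rewrite derive1E; exact: derive_val.
Qed.

Lemma measurable_unit_cube d : measurable (unit_cube R d).
Proof.
have -> : unit_cube R d = \bigcap_(i in [set: 'I_d]) ((fun x => tnth x i)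
  @^-1` `[0, 1]).
  apply/seteqP; split => [x h i _ /=|x h i]; first by rewrite in_itv /=;
    exact: h.
  by have := h i I; rewrite /= in_itv.
apply: fin_bigcap_measurable => // i _.
by rewrite -[_ @^-1` _]setTI; exact: measurable_tnth.
Qed.

Lemma cube_measure_cube d : cube_measure R d (unit_cube R d) = 1%E.
Proof.
elim: d => [|d IH].
  rewrite /= diracE mem_set // => i; by case: i.
rewrite /= /distribution /pushforward.
have -> : @cons_point R d @^-1` unit_cube R d.+1 = `[0, 1] `*` unit_cube R d.
  apply/seteqP; split => [[a x] /= h|[a x] /= [h1 h2]].
    split; first by have := h ord0; rewrite in_itv.
    by move=> i; have := h (lift ord0 i); rewrite tnthS.
  move=> i; case: (unliftP ord0 i) => [j ->|->]; last by move: h1;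
    rewrite in_itv.
  by rewrite tnthS.
rewrite product_measure1E //; last exact: measurable_unit_cube.
rewrite -[RHS]mule1; congr (_ * _)%E; last exact: IH.
exact: integral_uniform_pdf1.
Qed.

End CubeMeasure.

Section CubeIntegral.
Variable R : realType.

Lemma measurable_cos_dotp d (k : freq d) (t : R) :
  measurable_fun [set: d.-tuple R] (fun x => cos (t + 2 * pi * dotp k x)).
Proof.
apply: (measurableT_comp (continuous_measurable_fun (@continuous_cos R))).
apply: measurable_funD; first exact: measurable_cst.
apply: measurable_funM; first exact: measurable_cst.
apply: measurable_sum => i; apply: measurable_funM; first exact: measurable_cst.
exact: measurable_tnth.
Qed.

Lemma cos1_ge0 (t : R) : 0 <= 1 + cos t.
Proof. by rewrite -lerBlDl sub0r; exact: cos_geN1. Qed.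

Lemma dotp_cons d (k : freq d.+1) (a : R) (x : d.-tuple R) :
  dotp k [tuple of a :: x] =
  (k ord0)%:~R * a + dotp [ffun i => k (lift ord0 i)] x.
Proof.
rewrite /dotp big_ord_recl tnth0; congr (_ + _).
by apply: eq_bigr => i _; rewrite ffunE tnthS.
Qed.

Lemma freq_eq0 d (k : freq d.+1) :
  (k == 0) = (k ord0 == 0) && ([ffun i => k (lift ord0 i)] == 0 :> freq d).
Proof.
apply/eqP/andP => [->|[/eqP k0 /eqP/ffunP k1]].
  by rewrite ffunE eqxx; split => //; apply/eqP/ffunP => i; rewrite !ffunE.
apply/ffunP => i; rewrite ffunE; case: (unliftP ord0 i) => [j ->|-> //].
by have := k1 j; rewrite !ffunE.
Qed.

(** Induction on the dimension by Tonelli: integrating the first coordinate either removes the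
    cosine or, when its frequency is 0, leaves the integrand of the lower dimension. *)
Lemma integral_cube_cos d (k : freq d) (t : R) :
  (\int[cube_measure R d]_x (1 + cos (t + 2 * pi * dotp k x))%:E =
   (1 + (k == 0)%:R * cos t)%:E)%E.
Proof.
elim: d k t => [|d IH] k t.
  rewrite /= integral_dirac //; last first.
    apply/measurable_EFinP/measurable_funD; first exact: measurable_cst.
    exact: measurable_cos_dotp.
  rewrite diracT mul1e /dotp big_ord0 mulr0 addr0.
  by rewrite (_ : k == 0) ?mul1r //; apply/eqP/ffunP => -[].
have mf : measurable_fun [set: d.+1.-tuple R]
    (fun x => (1 + cos (t + 2 * pi * dotp k x))%:E).
  apply/measurable_EFinP/measurable_funD; first exact: measurable_cst.
  exact: measurable_cos_dotp.
have f0 x : (0 <= (1 + cos (t + 2 * pi * dotp k x))%:E)%E.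
  by rewrite lee_fin cos1_ge0.
rewrite [LHS]/= (ge0_integral_distribution _ mf f0).
rewrite fubini_tonelli2; last 2 first.
- by apply: (measurableT_comp mf); exact: measurable_cons_point.
- by move=> x; exact: f0.
pose k' : freq d := [ffun i => k (lift ord0 i)].
transitivity (\int[cube_measure R d]_y
    (1 + (k ord0 == 0)%:R * cos (t + 2 * pi * dotp k' y))%:E)%E.
  apply: eq_integral => y _; rewrite /fubini_G -integral_uniform_cos.
  apply: eq_integral => x _ /=; rewrite /cons_point /= dotp_cons -/k'.
  by congr (1 + cos _)%:E; ring.
rewrite freq_eq0 -/k'; case: (k ord0 == 0) => /=.
  by under eq_integral do rewrite mul1r; exact: IH.
under eq_integral do rewrite mul0r addr0.
rewrite mul0r addr0 (integral_cst _ measurableT) mul1e.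
exact: probability_setT.
Qed.

Lemma cube_integrable d (f : d.-tuple R -> R) (M : R) :
  measurable_fun setT f -> (forall x, unit_cube R d x -> `|f x| <= M) ->
  (cube_measure R d).-integrable (unit_cube R d) (EFin \o f).
Proof.
move=> mf fM; apply: measurable_bounded_integrable.
- exact: measurable_unit_cube.
- by rewrite -[ltLHS]/(cube_measure R d (unit_cube R d)) cube_measure_cube ltry.
- exact: measurable_funTS.
- exists M; split; first exact: num_real.
  by move=> y My x /fM /le_trans; apply; exact: ltW.
Qed.

Lemma cube_measureC d : cube_measure R d (~` unit_cube R d) = 0%E.
Proof.
rewrite probability_setC; last exact: measurable_unit_cube.
by rewrite cube_measure_cube subee.
Qed.

Lemma Rintegral_cube_cst d (c : R) :
  \int[cube_measure R d]_(x in unit_cube R d) c = c.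
Proof.
rewrite Rintegral_cst; last exact: measurable_unit_cube.
by rewrite -[X in fine X]/(cube_measure R d (unit_cube R d))
  cube_measure_cube mulr1.
Qed.

(** The complement of the cube is null, so the integral over the whole space is the one over the
    cube; subtracting the constant then undoes the shift by 1. *)
Lemma Rintegral_cube_cos d (k : freq d) (t : R) :
  \int[cube_measure R d]_(x in unit_cube R d) cos (t + 2 * pi * dotp k x) =
   (k == 0)%:R * cos t.
Proof.
have mc := measurable_cos_dotp k t.
have mD := @measurable_unit_cube R d.
have i1 : (cube_measure R d).-integrable (unit_cube R d) (EFin \o (fun=> 1)).
  by apply: (@cube_integrable _ _ 1) => // *; rewrite normr1.
have ic : (cube_measure R d).-integrable (unit_cube R d)
    (EFin \o (fun x => cos (t + 2 * pi * dotp k x))).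
  by apply: (@cube_integrable _ _ 1) => // x _;
    rewrite ler_norml cos_geN1 cos_le1.
have : \int[cube_measure R d]_(x in unit_cube R d)
  (1 + cos (t + 2 * pi * dotp k x))
    = 1 + (k == 0)%:R * cos t.
  have iT : (cube_measure R d).-integrable setT
      (EFin \o (fun x => 1 + cos (t + 2 * pi * dotp k x))).
    apply: measurable_bounded_integrable => //.
    - by rewrite -[ltLHS]/(cube_measure R d setT) probability_setT ltry.
    - by apply: measurable_funD => //; exact: measurable_cst.
    - exists 2; split; first exact: num_real.
      move=> y My x _ /=; apply: (le_trans _ (ltW My));
        rewrite ger0_norm ?cos1_ge0 //.
      by have := cos_le1 (t + 2 * pi * dotp k x); lra.
  rewrite /Rintegral -[RHS]/(fine (_%:E)) -integral_cube_cos; congr fine.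
  rewrite [RHS](negligible_integral (measurableC mD) measurableT iT);
    last first.
    exact: cube_measureC.
  by rewrite setDE setTI setCK.
move=> h; have := etrans (esym (RintegralD mD i1 ic)) h.
by rewrite Rintegral_cube_cst => /(addrI 1).
Qed.
End CubeIntegral.

Section ComplexCubeIntegral.
Variables (R : realType) (d : nat).
Implicit Types (f g : d.-tuple R -> R[i]) (c : R[i]).

Lemma Re_sum (I : Type) (r : seq I) (P : pred I) (F : I -> R[i]) :
  complex.Re (\sum_(i <- r | P i) F i) = \sum_(i <- r | P i) complex.Re (F i).
Proof. by apply: (big_morph (@complex.Re R)) => // -[a b] [a' b']. Qed.

Lemma Im_sum (I : Type) (r : seq I) (P : pred I) (F : I -> R[i]) :
  complex.Im (\sum_(i <- r | P i) F i) = \sum_(i <- r | P i) complex.Im (F i).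
Proof. by apply: (big_morph (@complex.Im R)) => // -[a b] [a' b']. Qed.

(** A class closed under sums and products that contains constants, characters and continuous
    functions, and on which [cube_integral] is linear. *)
Definition cube_bounded f : Prop :=
  [/\ measurable_fun setT (fun x => complex.Re (f x)),
      measurable_fun setT (fun x => complex.Im (f x)) &
      exists M, forall x, unit_cube R d x ->
        `|complex.Re (f x)| <= M /\ `|complex.Im (f x)| <= M].

Lemma cube_bounded_integrable f : cube_bounded f ->
  (cube_measure R d).-integrable (unit_cube R d) (EFin \o (fun x =>
    complex.Re (f x))) /\
  (cube_measure R d).-integrable (unit_cube R d) (EFin \o (fun x =>
    complex.Im (f x))).
Proof.
move=> [mr mi [M fM]]; split; apply: (@cube_integrable _ _ _ M) =>
  // x /fM [] //.
Qed.

Lemma cube_boundedM f g : cube_bounded f -> cube_bounded g ->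
  cube_bounded (fun x => f x * g x).
Proof.
move=> [fr fi [M fM]] [gr gi [L gL]].
have Re_mul x : complex.Re (f x * g x) =
    complex.Re (f x) * complex.Re (g x) - complex.Im (f x) * complex.Im (g x).
  by case: (f x) (g x) => ? ? [].
have Im_mul x : complex.Im (f x * g x) =
    complex.Re (f x) * complex.Im (g x) + complex.Im (f x) * complex.Re (g x).
  by case: (f x) (g x) => ? ? [].
split.
- by under eq_fun do rewrite Re_mul; apply: measurable_funB;
  exact: measurable_funM.
- by under eq_fun do rewrite Im_mul; apply: measurable_funD;
  exact: measurable_funM.
exists (M * L + M * L) => x cx; have [? ?] := fM x cx; have [? ?] := gL x cx.
rewrite Re_mul Im_mul; split.
  apply: le_trans (ler_normB _ _) _; rewrite !normrM.
  by apply: lerD; exact: ler_pM.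
apply: le_trans (ler_normD _ _) _; rewrite !normrM.
by apply: lerD; exact: ler_pM.
Qed.

Lemma cube_bounded_cst c : cube_bounded (fun=> c).
Proof.
split; [exact: measurable_cst|exact: measurable_cst|].
by exists (Num.max `|complex.Re c| `|complex.Im c|) => x _;
  rewrite !le_max !lexx orbT.
Qed.

Lemma cube_boundedD f g : cube_bounded f -> cube_bounded g ->
  cube_bounded (fun x => f x + g x).
Proof.
move=> [fr fi [M fM]] [gr gi [L gL]].
have Re_add x : complex.Re (f x + g x) = complex.Re (f x) + complex.Re (g x).
  by case: (f x) (g x) => ? ? [].
have Im_add x : complex.Im (f x + g x) = complex.Im (f x) + complex.Im (g x).
  by case: (f x) (g x) => ? ? [].
split.
- by under eq_fun do rewrite Re_add; exact: measurable_funD.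
- by under eq_fun do rewrite Im_add; exact: measurable_funD.
exists (M + L) => x cx; have [? ?] := fM x cx; have [? ?] := gL x cx.
rewrite Re_add Im_add; split; apply: le_trans (ler_normD _ _) _; exact: lerD.
Qed.

Lemma cube_bounded_sum (I : Type) (r : seq I) (F : I -> d.-tuple R -> R[i]) :
  (forall i, cube_bounded (F i)) -> cube_bounded (fun x => \sum_(i <- r) F i x).
Proof.
move=> hF; elim: r => [|i r IH].
  by under eq_fun do rewrite big_nil; exact: cube_bounded_cst.
by under eq_fun do rewrite big_cons; exact: cube_boundedD.
Qed.

Lemma cube_integralD f g : cube_bounded f -> cube_bounded g ->
  cube_integral (fun x => f x + g x) = cube_integral f + cube_integral g.
Proof.
move=> /cube_bounded_integrable[fr fi] /cube_bounded_integrable[gr gi].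
have mD := @measurable_unit_cube R d.
apply/eqP; rewrite /cube_integral eq_complex /=.
rewrite -(RintegralD mD fr gr) -(RintegralD mD fi gi).
by apply/andP; split; apply/eqP/eq_Rintegral => x _; case: (f x) (g x) =>
  ? ? [].
Qed.

Lemma cube_integralZ c f : cube_bounded f ->
  cube_integral (fun x => c * f x) = c * cube_integral f.
Proof.
move=> /cube_bounded_integrable[fr fi]; case: c => a b.
have mD := @measurable_unit_cube R d.
have iZ e h : (cube_measure R d).-integrable (unit_cube R d) (EFin \o h) ->
    (cube_measure R d).-integrable (unit_cube R d) (EFin \o (fun x => e * h x)).
  by move=> ih; exact: (integrableZl mD e ih).
apply/eqP; rewrite /cube_integral eq_complex /=.
rewrite -!(RintegralZl _ mD) //.
rewrite -(RintegralB mD (iZ _ _ fr) (iZ _ _ fi)) -(RintegralD mD (iZ _ _ fi)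
  (iZ _ _ fr)).
by apply/andP; split; apply/eqP/eq_Rintegral => x _; case: (f x).
Qed.

Lemma cube_integral_sum (I : Type) (r : seq I) (F : I -> d.-tuple R -> R[i]) :
  (forall i, cube_bounded (F i)) ->
  cube_integral (fun x => \sum_(i <- r) F i x) = \sum_(i <- r)
    cube_integral (F i).
Proof.
move=> hF; elim: r => [|i r IH].
  under eq_fun do rewrite big_nil.
  by rewrite big_nil /cube_integral /= !Rintegral_cube_cst.
under eq_fun do rewrite big_cons.
by rewrite big_cons cube_integralD // ?IH //; exact: cube_bounded_sum.
Qed.

Lemma cube_bounded_chi (k : freq d) : cube_bounded (chi k).
Proof.
(* The sine is a cosine with phase -pi/2, so [measurable_cos_dotp] covers both parts. *)
have Ech x : (chi k x : R[i]) = (cos (0 + 2 * pi * dotp k x)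
  +i* cos (- (pi / 2) + 2 * pi * dotp k x))%C.
  by rewrite add0r [- _ + _]addrC cosBpihalf.
split.
- by under eq_fun do rewrite Ech; exact: measurable_cos_dotp.
- by under eq_fun do rewrite Ech; exact: measurable_cos_dotp.
by exists 1 => x _; rewrite Ech /= !ler_norml !cos_geN1 !cos_le1.
Qed.

End ComplexCubeIntegral.

(** * Fejer means *)

Section ContinuousOnCube.
Variables (R : realType) (d : nat).

(** Tuples carry the sigma-algebra and row vectors the topology; this passes from the former to the
    latter. *)
Definition row_of (x : d.-tuple R) : 'rV[R]_d := \row_i tnth x i.

(* [h] is the pointwise limit of its values at the points rounded down to the
   grid of mesh [1/(m+1)], and these approximants factor through a countable
   type. *)
Lemma continuous_measurable_rV (h : 'rV[R]_d -> R) :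
  continuous h -> measurable_fun setT (fun x => h (row_of x)).
Proof.
move=> hc.
pose cell m (x : d.-tuple R) : freq d := [ffun i =>
  Num.floor (m.+1%:R * tnth x i)].
pose pt m (k : freq d) : 'rV[R]_d := \row_i ((k i)%:~R / m.+1%:R).
apply: (@measurable_fun_cvg _ _ _ _ (fun m x => h (pt m (cell m x)))).
  move=> m _ Y mY; rewrite setTI.
  have -> : (fun x => h (pt m (cell m x))) @^-1` Y =
      \bigcup_(k in [set k | Y (h (pt m k))]) (cell m @^-1` [set k]).
    apply/seteqP; split => [x Yx|x [k Yk /= xk]]; last by rewrite /= xk.
    by exists (cell m x).
  rewrite bigcup_mkcond; apply: countable_bigcupT_measurable => [|k].
    exact: countableP.
  case: ifP => // _.
  have -> : cell m @^-1` [set k] = \bigcap_(i in [set: 'I_d])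
      ((fun x => tnth x i) @^-1` [set y | (k i)%:~R <= m.+1%:R * y < (k i +
        1)%:~R]).
    apply/seteqP; split => [x /= xk i _ /=|x xk /=].
      by rewrite -xk ffunE floor_itv.
    by apply/ffunP => i; rewrite ffunE; apply: floor_def; exact: (xk i I).
  apply: fin_bigcap_measurable => // i _.
  rewrite -[_ @^-1` _]setTI; apply: measurable_tnth => //.
  rewrite (_ : [set y | _] = `[(k i)%:~R / m.+1%:R, (k i + 1)%:~R /
    m.+1%:R[%classic).
    exact: measurable_itv.
  by apply/seteqP; split => y /=;
    rewrite in_itv /= ler_pdivrMr // ltr_pdivlMr // mulrC.
move=> x _; apply: (cvg_comp (fun m => pt m (cell m x)) h _ (hc (row_of x))).
apply/cvg_ballP => e e0; near=> m; split=> [//|i j].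
rewrite !mxE ffunE /ball /=.
have m0 : (0 : R) < m.+1%:R by rewrite ltr0n.
have /andP[fl fu] := floor_itv (m.+1%:R * tnth x j).
rewrite ger0_norm; last by rewrite subr_ge0 ler_pdivrMr // [leRHS]mulrC.
apply: (@le_lt_trans _ _ m.+1%:R^-1).
  rewrite lerBlDr -[X in X + _]div1r -mulrDl ler_pdivlMr // [leLHS]mulrC ltW //.
  by rewrite addrC; rewrite intrD in fu.
near: m; exact: (near_infty_natSinv_lt (PosNum e0)).
Unshelve. all: by end_near.
Qed.

Lemma continuous_bounded_cube (h : 'rV[R]_d -> R) :
  continuous h ->
  exists M, forall x, unit_cube R d x -> `|h (row_of x)| <= M.
Proof.
move=> hc.
have K : compact [set v : 'rV[R]_d | forall i :
  'I_d, `[0, 1]%classic (v ord0 i)].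
  by apply: (@rV_compact R d (fun=> `[0, 1]%classic)) => i;
    exact: segment_compact.
have [M [_ hM]] := compact_bounded (continuous_compact (continuous_subspaceT
  hc) K).
exists (M + 1) => x xc; apply: (hM (M + 1)); first by rewrite ltrDl.
exists (row_of x) => // i /=; rewrite mxE in_itv /=; exact: xc.
Qed.

End ContinuousOnCube.

(** * Korovkin's estimate for periodic functions *)

Section Korovkin.
Variables (R : realType) (d : nat).
Implicit Types (x y : d.-tuple R).

Definition periodic_real (h : d.-tuple R -> R) : Prop :=
  forall (j : 'I_d) x, h [tuple tnth x i + (i == j)%:R | i < d] = h x.

Lemma periodic_shift (h : d.-tuple R -> R) (m : 'I_d -> int) x :
  periodic_real h -> h [tuple tnth x i + (m i)%:~R | i < d] = h x.
Proof.
move=> hp.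
have shiftn (j : 'I_d) (n : nat) z :
  h [tuple tnth z i + (i == j)%:R * n%:R | i < d] = h z.
  elim: n z => [|n IH] z.
    by congr h; apply: eq_from_tnth => i; rewrite tnth_mktuple mulr0 addr0.
  rewrite -[RHS]IH -[RHS](hp j); congr h; apply: eq_from_tnth => i.
  by rewrite !tnth_mktuple -addrA -[n.+1]addn1 natrD mulrDr mulr1.
have shiftz (j : 'I_d) (n : int) z :
    h [tuple tnth z i + (i == j)%:R * n%:~R | i < d] = h z.
  case: n => n; first exact: shiftn.
  rewrite -[LHS](shiftn j n.+1); congr h; apply: eq_from_tnth => i.
  by rewrite !tnth_mktuple NegzE mulrNz mulrN subrK.
have shifts (r : seq 'I_d) z :
    h [tuple tnth z i + \sum_(j <- r) (i == j)%:R * (m j)%:~R | i < d] = h z.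
  elim: r z => [|j r IH] z.
    by congr h; apply: eq_from_tnth => i; rewrite tnth_mktuple big_nil addr0.
  rewrite -[RHS]IH -[RHS](shiftz j (m j)); congr h; apply: eq_from_tnth => i.
  by rewrite !tnth_mktuple big_cons [X in _ + X]addrC addrA.
rewrite -[RHS](shifts (index_enum 'I_d)); congr h; apply: eq_from_tnth => i.
rewrite !tnth_mktuple (bigD1 i) //= eqxx mul1r big1 ?addr0 // => j ji.
by rewrite eq_sym (negbTE ji) mul0r.
Qed.

(* Korovkin's argument: the kernel has mass [1] and its integral against the right
   hand side below is [eps + O(1/n)]. *)
Lemma korovkin_bound (h : d.-tuple R -> R) y (eps : R) :
  continuous (fun v : 'rV[R]_d => h [tuple v ord0 i | i < d]) ->
  periodic_real h -> unit_cube R d y -> 0 < eps ->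
  exists2 C, 0 <= C & forall x, unit_cube R d x ->
    `|h x - h y| <= eps + C * \sum_j (1 - cos (2 * pi * (tnth x j - tnth y j))).
Proof.
move=> hc hp yc eps0.
have rowK x : [tuple row_of x ord0 i | i < d] = x.
  by apply: eq_from_tnth => i; rewrite tnth_mktuple mxE.
have [M hM] := continuous_bounded_cube hc.
have [delta [delta0 delta2] near_y] : exists2 delta :
  R, 0 < delta /\ delta < 2^-1 &
    forall x, (forall j, `|tnth y j - tnth x j| < delta) -> `|h y - h x| < eps.
  have /cvg_ballP/(_ eps eps0)/nbhs_ballP[e e0 he] := hc (row_of y).
  exists (Num.min e 3^-1).
    by rewrite lt_min e0 /= gt_min; split; [lra|apply/orP; right; lra].
  move=> x xy; have := he (row_of x); rewrite /ball /= !rowK; apply.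
  split => // i j; rewrite !mxE /ball /=.
  by apply: lt_le_trans (xy j) _; rewrite ge_min lexx.
have M0 : 0 <= M by have := hM y yc; exact: le_trans.
(* A lower bound for the cosine term of a coordinate whose distance to y_j modulo 1 is at least
   [delta]. *)
pose kappa := 1 - cos (2 * pi * delta).
have kappa0 : 0 < kappa.
  by rewrite subr_gt0; apply: cos_2pi_lt1; rewrite delta0 /=; lra.
have term0 x j : 0 <= 1 - cos (2 * pi * (tnth x j - tnth y j)).
  by rewrite subr_ge0 cos_le1.
exists (2 * M / kappa) => [|x xc]; first by rewrite divr_ge0 ?mulr_ge0 // ltW.
have S0 : 0 <= \sum_j (1 - cos (2 * pi * (tnth x j - tnth y j)))
  by exact: sumr_ge0.
(* Far case: some coordinate is at distance at least [delta] from y_j modulo 1, and the trivial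
   bound 2 M is paid for by the cosine sum, which is at least [kappa]. *)
have [/existsP[j /andP[dj jd]]|] := boolP [exists j,
    (delta <= `|tnth x j - tnth y j|) && (`|tnth x j - tnth y j| <= 1 - delta)].
  apply: (@le_trans _ _ (2 * M)).
    apply: le_trans (ler_normB _ _) _; have := hM x xc; have := hM y yc.
    by rewrite !rowK; lra.
  apply: (@le_trans _ _ (2 * M / kappa * kappa)).
    by rewrite divfK // gt_eqF.
  apply: ler_wpDl; first exact: ltW.
  rewrite ler_wpM2l ?divr_ge0 ?mulr_ge0 ?(ltW kappa0) //.
  rewrite (bigD1 j) //=; apply: ler_wpDr; first exact: sumr_ge0.
  rewrite /kappa lerD2l lerN2.
  have -> : cos (2 * pi * (tnth x j - tnth y j)) =
      cos (2 * pi * `|tnth x j - tnth y j|).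
    by case: (ger0P (tnth x j - tnth y j)) => // _; rewrite mulrN cosN.
  by apply: cos_2pi_le; rewrite ?(ltW delta0) ?dj ?jd.
rewrite negb_exists => /forallP far.
(* Near case: each difference is below [delta] or above 1 - delta in modulus, so a shift by 0, 1 or
   -1 brings x_j within [delta] of y_j, and periodicity absorbs it. *)
have [m hm] : exists m : 'I_d -> int, forall j, `|tnth y j - (tnth x j + (m
  j)%:~R)| < delta.
  suff /choice[m hm] : forall j, exists m : int,
    `|tnth y j - (tnth x j + m%:~R)| < delta by exists m.
  move=> j.
  have /andP[x0 x1] := xc j; have /andP[y0 y1] := yc j.
  have := far j; rewrite negb_and -!ltNge => /orP[close|wrap].
    by exists 0; rewrite addr0 distrC.
  have [xy|xy] := lerP (tnth y j) (tnth x j).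
    move: wrap; rewrite ger0_norm ?subr_ge0 // => wrap.
    by exists (-1); rewrite ltr_norml mulrN1z; apply/andP; split; lra.
  move: wrap; rewrite ltr0_norm ?subr_lt0 // => wrap.
  by exists 1; rewrite ltr_norml mulr1z; apply/andP; split; lra.
rewrite -(periodic_shift m x hp) distrC; apply: ler_wpDr.
  by rewrite mulr_ge0 // divr_ge0 ?mulr_ge0 // ltW.
by apply/ltW/near_y => j; rewrite tnth_mktuple.
Qed.

End Korovkin.

(** * The Fejer kernel and its moments *)

Section FejerKernel.
Variables (R : realType) (d n : nat) (y : d.-tuple R).
Implicit Types (x : d.-tuple R) (k l : freq d).

Local Notation P := {ffun 'I_d -> 'I_n.+1}.

Definition fr (a : P) : freq d := [ffun j => (a j : nat)%:Z].
Definition axis (j : 'I_d) : freq d := [ffun i => (i == j)%:Z].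
Definition cosdiff k x : R := cos (2 * pi * (dotp k x - dotp k y)).

Let p : R := #|{: P}|%:R.

(* [p^-1 |sum_a e(a . (x - y))|^2] for [a] in [{0, ..., n}^d]. *)
Definition fejer x : R := p^-1 * \sum_(a : P) \sum_(b : P)
  cosdiff (fr b - fr a) x.

Let p_gt0 : 0 < p.
Proof. by rewrite ltr0n card_ffun !card_ord expn_gt0. Qed.

Lemma fr_inj : injective fr.
Proof.
move=> a b /ffunP ab; apply/ffunP => j; apply: val_inj.
by have := ab j; rewrite !ffunE => -[].
Qed.

Lemma dotp_axis j x : dotp (axis j) x = tnth x j.
Proof.
rewrite /dotp (bigD1 j) //= ffunE eqxx mul1r big1 ?addr0 // => i ij.
by rewrite ffunE (negbTE ij) mul0r.
Qed.

Lemma fejer_ge0 x : 0 <= fejer x.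
Proof.
rewrite mulr_ge0 ?invr_ge0 ?(ltW p_gt0) //.
pose u (a : P) := 2 * pi * (dotp (fr a) x - dotp (fr a) y).
have -> : \sum_(a : P) \sum_(b : P) cosdiff (fr b - fr a) x =
    (\sum_a cos (u a)) ^+ 2 + (\sum_a sin (u a)) ^+ 2.
  rewrite !expr2 !mulr_suml -big_split; apply: eq_bigr => a _ /=.
  rewrite !mulr_sumr -big_split; apply: eq_bigr => b _ /=.
  rewrite /cosdiff -cosB -cosN; congr cos; rewrite !dotpD !dotpN /u; ring.
by rewrite addr_ge0 ?sqr_ge0.
Qed.

Lemma cosdiff_integrable k : (cube_measure R d).-integrable (unit_cube R d)
  (EFin \o cosdiff k).
Proof.
have -> : cosdiff k = (fun x => cos (- (2 * pi * dotp k y)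
  + 2 * pi * dotp k x)).
  by apply/funext => x; rewrite /cosdiff; congr cos; ring.
apply: (@cube_integrable _ _ _ 1); first exact: measurable_cos_dotp.
by move=> x _; rewrite ler_norml cos_geN1 cos_le1.
Qed.

Lemma Rintegral_cosdiff k :
  \int[cube_measure R d]_(x in unit_cube R d) cosdiff k x = (k == 0)%:R.
Proof.
transitivity (\int[cube_measure R d]_(x in unit_cube R d)
    cos (- (2 * pi * dotp k y) + 2 * pi * dotp k x)).
  by apply: eq_Rintegral => x _; rewrite /cosdiff; congr cos; ring.
rewrite Rintegral_cube_cos; case: eqP => [->|]; rewrite ?mul0r // mul1r.
have -> : dotp 0 y = 0 by rewrite /dotp big1 // => i _; rewrite ffunE mul0r.
by rewrite mulr0 oppr0 cos0.
Qed.

Lemma Rintegral_sum (I : Type) (r : seq I) (F : I -> d.-tuple R -> R) :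
  (forall i, (cube_measure R d).-integrable (unit_cube R d) (EFin \o F i)) ->
  (cube_measure R d).-integrable (unit_cube R d)
    (EFin \o (fun x => \sum_(i <- r) F i x)) /\
  \int[cube_measure R d]_(x in unit_cube R d) (\sum_(i <- r) F i x) =
    \sum_(i <- r) \int[cube_measure R d]_(x in unit_cube R d) F i x.
Proof.
have mD := @measurable_unit_cube R d.
move=> hF; elim: r => [|i r [IH1 IH2]].
  under eq_fun do rewrite big_nil.
  split; last first.
    rewrite big_nil -[RHS](Rintegral_cube_cst d 0).
    by apply: eq_Rintegral => x _; rewrite ?big_nil.
  apply: (@cube_integrable _ _ _ 0) => [|x _]; first exact: measurable_cst.
  by rewrite normr0.
split.
  under eq_fun do rewrite big_cons.
  exact: (integrableD mD (hF i) IH1).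
rewrite big_cons -IH2 -(RintegralD mD (hF i) IH1).
by apply: eq_Rintegral => x _; rewrite big_cons.
Qed.

(** Integration kills every pair a <> b, and each of the p diagonal pairs contributes 1. *)
Lemma Rintegral_fejer : (cube_measure R d).-integrable (unit_cube R d)
  (EFin \o fejer) /\
  \int[cube_measure R d]_(x in unit_cube R d) fejer x = 1.
Proof.
have mD := @measurable_unit_cube R d.
have inner (a : P) := Rintegral_sum (index_enum P) (fun b =>
  cosdiff_integrable (fr b - fr a)).
have [i1 i2] := Rintegral_sum (index_enum P) (fun a => (inner a).1).
split; first exact: (integrableZl mD p^-1 i1).
rewrite /fejer (RintegralZl p^-1 mD i1) i2.
under eq_bigr => a _.
  rewrite (inner a).2.
  under eq_bigr do rewrite Rintegral_cosdiff subr_eq0 (inj_eq fr_inj).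
  rewrite (bigD1 a) //= eqxx big1 ?addr0; last by move=> b /negbTE ->.
  over.
by rewrite sumr_const mulVf // gt_eqF.
Qed.

Lemma card_face (j : 'I_d) : (#|[set a :
  P | a j == ord_max]%SET| * n.+1 <= #|{: P}|)%N.
Proof.
pose f (at' : P * 'I_n.+1) : P := [ffun i => if i == j then at'.2 else at'.1 i].
set A := [set a | _]%SET.
have -> : (#|A| * n.+1)%N = #|finset.setX A [set: 'I_n.+1]%SET|.
  by rewrite cardsX cardsT card_ord.
rewrite -(@card_in_imset _ _ f); first exact: max_card.
move=> [a t] [a' t']; rewrite !inE /= !andbT => /eqP aj /eqP aj' /ffunP h.
congr (_, _); last by have := h j; rewrite !ffunE eqxx.
apply/ffunP => i; have := h i; rewrite !ffunE.
by case: eqP => // -> _; rewrite aj aj'.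
Qed.

(** Multiplying by the cosine shifts frequencies by plus or minus [axis j], so the integral counts
    neighbours in direction j. Only grid points on the face a_j = n lack an upper neighbour, and by
    [card_face] they are at most a share 1/(n+1) of the grid. *)
Lemma Rintegral_fejer_cos (j : 'I_d) :
  (cube_measure R d).-integrable (unit_cube R d)
    (EFin \o (fun x => fejer x * (1 - cos (2 * pi * (tnth x j - tnth y j))))) /\
  \int[cube_measure R d]_(x in unit_cube R d)
     (fejer x * (1 - cos (2 * pi * (tnth x j - tnth y j)))) <= n.+1%:R^-1.
Proof.
have mD := @measurable_unit_cube R d.
pose F (a b : P) x := cosdiff (fr b - fr a) x -
  2^-1 * (cosdiff (fr b - fr a + axis j) x + cosdiff (fr b - fr a - axis j) x).
have expand x : fejer x * (1 - cos (2 * pi * (tnth x j - tnth y j))) =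
    p^-1 * \sum_(a : P) \sum_(b : P) F a b x.
  rewrite /fejer -(mulrA p^-1); congr (_ * _); rewrite mulr_suml;
    apply: eq_bigr => a _.
  rewrite mulr_suml; apply: eq_bigr => b _.
  have -> : cos (2 * pi * (tnth x j - tnth y j)) = cosdiff (axis j) x.
    by rewrite /cosdiff !dotp_axis.
  rewrite /F mulrBr mulr1; congr (_ - _).
  have -> : cosdiff (fr b - fr a + axis j) x =
      cos (2 * pi * (dotp (fr b - fr a) x - dotp (fr b - fr a) y)
         + 2 * pi * (dotp (axis j) x - dotp (axis j) y)).
    by rewrite /cosdiff; congr cos; rewrite [in LHS]dotpD [in X in _ - X]dotpD;
      ring.
  have -> : cosdiff (fr b - fr a - axis j) x =
      cos (2 * pi * (dotp (fr b - fr a) x - dotp (fr b - fr a) y)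
         - 2 * pi * (dotp (axis j) x - dotp (axis j) y)).
    by rewrite /cosdiff; congr cos; rewrite ![dotp (_ - axis j)
      _]dotpD ![dotp (- axis j) _]dotpN; ring.
  by rewrite cosD cosB /cosdiff; field.
have iF a b : (cube_measure R d).-integrable (unit_cube R d) (EFin \o F a b).
  have i1 := integrableD mD (cosdiff_integrable (fr b - fr a + axis j))
    (cosdiff_integrable (fr b - fr a - axis j)).
  have i2 := integrableZl mD 2^-1 i1.
  exact: (integrableB mD (cosdiff_integrable (fr b - fr a)) i2).
have iFE a b : \int[cube_measure R d]_(x in unit_cube R d) F a b x =
    (a == b)%:R - 2^-1 * ((fr b - fr a + axis j == 0)%:R + (fr b - fr a - axis
      j == 0)%:R).
  have ip := cosdiff_integrable (fr b - fr a + axis j).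
  have im := cosdiff_integrable (fr b - fr a - axis j).
  have i1 := integrableD mD ip im.
  apply: (etrans (RintegralB mD (cosdiff_integrable (fr b - fr a))
    (integrableZl mD 2^-1 i1))).
  congr (_ - _); first by rewrite Rintegral_cosdiff subr_eq0 (inj_eq fr_inj)
    eq_sym.
  apply: (etrans (RintegralZl 2^-1 mD i1)); congr (_ * _).
  by apply: (etrans (RintegralD mD ip im)); rewrite !Rintegral_cosdiff.
have inner (a : P) := Rintegral_sum (index_enum P) (iF a).
have [i1 i2] := Rintegral_sum (index_enum P) (fun a => (inner a).1).
have -> : (fun x => fejer x * (1 - cos (2 * pi * (tnth x j - tnth y j)))) =
    (fun x => p^-1 * \sum_(a : P) \sum_(b : P) F a b x).
  by apply/funext => x; exact: expand.
split; first exact: (integrableZl mD p^-1 i1).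
rewrite (RintegralZl p^-1 mD i1) i2.
(* [S] counts the pairs with b = a + e_j. Exchanging [a] and [b] gives the same count for the
   opposite shift, which cancels the factor 1/2. *)
pose S : R := \sum_(a : P) \sum_(b : P) (fr b - fr a - axis j == 0)%:R.
have -> : \sum_(a : P) \int[cube_measure R d]_(x in unit_cube R d)
    (\sum_(b : P) F a b x) = p - S.
  under eq_bigr => a _ do rewrite (inner a).2 (eq_bigr _ (fun b _ => iFE a b))
    sumrB.
  rewrite sumrB; congr (_ - _).
    under eq_bigr => a _.
      rewrite (bigD1 a) //= eqxx big1 ?addr0; last by move=> b;
        rewrite eq_sym => /negbTE ->.
      over.
    by rewrite sumr_const.
  under eq_bigr => a _ do rewrite -mulr_sumr big_split /=.
  rewrite -mulr_sumr big_split /=.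
  have -> : \sum_(a : P) \sum_(b : P) (fr b - fr a + axis j == 0)%:R = S.
    rewrite exchange_big; apply: eq_bigr => a _; apply: eq_bigr => b _.
    by rewrite -oppr_eq0 opprD opprB.
  by rewrite -/S; field.
(* A point off the face a_j = n has the neighbour a + e_j, which contributes 1. *)
have Sge : \sum_(a : P) (1 - (a j == ord_max)%:R) <= S.
  apply: ler_sum => a _; case: eqVneq => [_|aj] /=.
    by rewrite subrr sumr_ge0.
  have aj' : (a j < n)%N.
    by rewrite ltn_neqAle -ltnS ltn_ord andbT; apply: contra aj => /eqP h;
      apply/eqP/val_inj.
  pose b : P := [ffun i => if i == j then inord (a j).+1 else a i].
  rewrite subr0 (bigD1 b) //= (_ : _ == 0) ?lerDl ?sumr_ge0 //.
  apply/eqP/ffunP => i; rewrite !ffunE; case: (eqVneq i j) => [->|_].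
    by rewrite inordK ?ltnS // intS addrK.
  by rewrite subrr.
move: Sge; rewrite sumrB sumr_const -natr_sum -/p.
have -> : (\sum_(a : P) (a j == ord_max))%N = #|[set a :
  P | a j == ord_max]%SET|.
  by rewrite -sum1dep_card [RHS]big_mkcond /=; apply: eq_bigr => a _; case: eqP.
move=> Sge; rewrite mulrC ler_pdivrMr // mulrC ler_pdivlMr ?ltr0n //.
apply: (@le_trans _ _ (#|[set a : P | a j == ord_max]%SET|%:R * n.+1%:R)).
  by rewrite ler_wpM2r //; lra.
by rewrite -natrM ler_nat card_face.
Qed.
End FejerKernel.

Section FejerApproximation.
Variables (R : realType) (d : nat).
Implicit Types (x y : d.-tuple R).

Lemma measurable_fejer n y : measurable_fun setT (fejer n y).
Proof.
apply: measurable_funM; first exact: measurable_cst.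
apply: measurable_sum => a; apply: measurable_sum => b.
have -> : cosdiff y (fr b - fr a) =
    (fun x => cos (- (2 * pi * dotp (fr b - fr a) y)
      + 2 * pi * dotp (fr b - fr a) x)).
  by apply/funext => x; rewrite /cosdiff; congr cos; ring.
exact: measurable_cos_dotp.
Qed.

Lemma fejer_le n y x : fejer n y x <= #|{: {ffun 'I_d -> 'I_n.+1}}|%:R.
Proof.
set p := #|_|; have p0 : (0 : R) < p%:R.
  by rewrite ltr0n /p card_ffun !card_ord expn_gt0.
rewrite /fejer mulrC ler_pdivrMr // -/p.
have -> : p%:R * p%:R = \sum_(a : {ffun 'I_d -> 'I_n.+1}) \sum_(b :
  {ffun 'I_d -> 'I_n.+1}) (1 : R).
  rewrite (eq_bigr (fun=> p%:R)) => [|a _]; last by rewrite sumr_const.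
  by rewrite sumr_const -[RHS]mulr_natl.
by apply: ler_sum => a _; apply: ler_sum => b _; exact: cos_le1.
Qed.

(** As the kernel has mass 1, the difference is the integral of (h x - h y) against it;
    [korovkin_bound] at eps/2 bounds this by eps/2 + C d / (n+1). *)
Lemma fejer_approx_real (h : d.-tuple R -> R) y (eps : R) :
  continuous (fun v : 'rV[R]_d => h [tuple v ord0 i | i < d]) ->
  periodic_real h -> unit_cube R d y -> 0 < eps ->
  exists n0, forall n, (n0 <= n)%N ->
    `|\int[cube_measure R d]_(x in unit_cube R d) (h x * fejer n y x)
      - h y| <= eps.
Proof.
move=> hc hp yc eps0.
have rowK x : [tuple row_of x ord0 i | i < d] = x.
  by apply: eq_from_tnth => i; rewrite tnth_mktuple mxE.
have mh : measurable_fun setT h.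
  have -> : h = (fun x => h [tuple row_of x ord0 i | i < d]).
    by apply/funext => x; rewrite rowK.
  exact: (continuous_measurable_rV hc).
have [M hM] := continuous_bounded_cube hc.
have mD := @measurable_unit_cube R d.
have e20 : 0 < eps / 2 by rewrite divr_gt0.
have [C C0 hC] := korovkin_bound hc hp yc e20.
(* From this [n0] on, C d / (n+1) is at most eps/2. *)
have [n0 hn0] : exists n0 : nat, C * d%:R <= (eps / 2) * n0%:R.
  exists (Num.trunc (C * d%:R / (eps / 2))).+1;
    rewrite [leRHS]mulrC -ler_pdivrMr //.
  by rewrite ltW // truncnS_gt.
exists n0 => n n0n.
set K := fejer n y.
pose B x := eps / 2 * K x + C * \sum_j (K x * (1 - cos (2 * pi * (tnth x j -
  tnth y j)))).
have [iK intK] := Rintegral_fejer n y.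
have [iS intS] := Rintegral_sum (index_enum 'I_d) (fun j =>
  (Rintegral_fejer_cos n y j).1).
have iB : (cube_measure R d).-integrable (unit_cube R d) (EFin \o B).
  exact: (integrableD mD (integrableZl mD _ iK) (integrableZl mD _ iS)).
have intB : \int[cube_measure R d]_(x in unit_cube R d) B x <= eps.
  rewrite (_ : \int[_]_(x in _) B x = eps / 2 * 1 + C * \sum_j
      \int[cube_measure R d]_(x in unit_cube R d)
        (K x * (1 - cos (2 * pi * (tnth x j - tnth y j))))).
    rewrite mulr1 [leRHS](splitr eps) lerD2l.
    apply: (@le_trans _ _ (C * \sum_(j < d) n.+1%:R^-1)).
      by rewrite ler_wpM2l // ler_sum // => j _;
        exact: (Rintegral_fejer_cos n y j).2.
    rewrite sumr_const card_ord -[_ *+ d]mulr_natl mulrA ler_pdivrMr ?ltr0n //.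
    apply: le_trans hn0 _; rewrite ler_wpM2l ?(ltW e20) // ler_nat.
    exact: leqW.
  apply: (etrans (RintegralD mD (integrableZl mD _ iK) (integrableZl mD _ iS))).
  congr (_ + _); first by apply: (etrans (RintegralZl _ mD iK)); rewrite intK.
  by apply: (etrans (RintegralZl _ mD iS)); rewrite intS.
have ihK : (cube_measure R d).-integrable (unit_cube R d) (EFin \o (fun x =>
  h x * K x)).
  apply: (@cube_integrable _ _ _ (M * #|{: {ffun 'I_d -> 'I_n.+1}}|%:R)).
    by apply: measurable_funM => //; exact: measurable_fejer.
  move=> x xc; rewrite normrM; apply: ler_pM => //.
    by have := hM x xc; rewrite rowK.
  by rewrite ger0_norm ?fejer_ge0 // fejer_le.
have iyK := integrableZl mD (h y) iK.
have idiff : (cube_measure R d).-integrable (unit_cube R d)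
    (EFin \o (fun x => h x * K x - h y * K x)) := integrableB mD ihK iyK.
have -> : \int[cube_measure R d]_(x in unit_cube R d) (h x * K x) - h y =
    \int[cube_measure R d]_(x in unit_cube R d) (h x * K x - h y * K x).
  rewrite -[X in _ - X]mulr1 -intK.
  have E1 := RintegralZl (h y) mD iK; have E2 := RintegralB mD ihK iyK.
  by apply: esym; apply: (etrans E2); congr (_ - _); exact: E1.
have pointwise x : unit_cube R d x -> `|h x * K x - h y * K x| <= B x.
  move=> xc; rewrite -mulrBl normrM [X in _ * X]ger0_norm ?fejer_ge0 //.
  have -> : B x = (eps / 2 +
      C * \sum_j (1 - cos (2 * pi * (tnth x j - tnth y j)))) * K x.
    by rewrite /B -mulr_sumr; ring.
  by rewrite ler_wpM2r ?fejer_ge0 // hC.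
rewrite ler_norml; apply/andP; split.
  rewrite lerNl; apply: le_trans intB.
  have iN : (cube_measure R d).-integrable (unit_cube R d)
      (EFin \o (fun x => -1 * (h x * K x - h y * K x))) := integrableZl mD (-1)
        idiff.
  have -> : - (\int[cube_measure R d]_(x in unit_cube R d)
    (h x * K x - h y * K x)) =
      \int[cube_measure R d]_(x in unit_cube R d)
        (-1 * (h x * K x - h y * K x)).
    by rewrite -[LHS]mulN1r; apply: esym; exact: (RintegralZl (-1) mD idiff).
  apply: le_Rintegral => // x xc.
  by rewrite mulN1r; have := pointwise x xc; rewrite ler_norml lerNl => /andP[].
apply: le_trans intB; apply: le_Rintegral => // x xc.
by have := pointwise x xc; rewrite ler_norml => /andP[].
Qed.

End FejerApproximation.

Section FejerMeans.
Variables (R : realType) (d : nat).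
Implicit Types (x y : d.-tuple R) (f : d.-tuple R -> R[i]).

Local Notation P n := {ffun 'I_d -> 'I_n.+1}.

(** Summing over pairs encodes the usual weights: for |k_j| <= n, the frequency k = a - b occurs for
    a share prod_j (1 - |k_j|/(n+1)) relative to (n+1)^d. *)
Definition fejer_mean n f y : R[i] :=
  (#|{: P n}|%:R^-1) * \sum_(a : P n) \sum_(b : P n)
     fourier f (fr a - fr b) * chi (fr a - fr b) y.

Lemma fejer_complex n y x : (fejer n y x +i* 0)%C =
  (#|{: P n}|%:R^-1) * \sum_(a : P n) \sum_(b : P n)
     chi (fr a - fr b) y * expi (- (2 * pi * dotp (fr a - fr b) x)) :> R[i].
Proof.
pose u (a b : P n) := 2 * pi * (dotp (fr a - fr b) y - dotp (fr a - fr b) x).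
have -> : \sum_(a : P n) \sum_(b : P n)
    chi (fr a - fr b) y * expi (- (2 * pi * dotp (fr a - fr b) x)) =
    ((\sum_(a : P n) \sum_(b : P n) cosdiff y (fr b - fr a) x) +i* 0)%C :> R[i].
  under eq_bigr do under eq_bigr do rewrite /chi -expiD -mulrN -mulrDr.
  apply/eqP; rewrite eq_complex Re_sum Im_sum /=; apply/andP; split; apply/eqP.
    apply: eq_bigr => a _; rewrite Re_sum; apply: eq_bigr => b _ /=.
    by rewrite /cosdiff; congr cos; rewrite !dotpD !dotpN; ring.
  under eq_bigr do rewrite Im_sum.
  (* Exchanging [a] and [b] negates each sine, so the imaginary part vanishes. *)
  set S := \sum_(a : P n) _; suff : S = - S by move=> h; have :
    S + S = 0 by [rewrite {1}h addNr]; lra.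
  rewrite /S -sumrN exchange_big; apply: eq_bigr => a _; rewrite -sumrN.
  apply: eq_bigr => b _ /=; rewrite -sinN; congr sin.
  by rewrite !dotpD !dotpN; ring.
have -> : #|{: P n}|%:R^-1 = (#|{: P n}|%:R^-1 +i* 0)%C :> R[i].
  have m0 : (#|{: P n}|%:R : R) != 0.
    by rewrite pnatr_eq0 -lt0n card_ffun !card_ord expn_gt0.
  have mc0 : (#|{: P n}|%:R : R[i]) != 0.
    by rewrite pnatr_eq0 -lt0n card_ffun !card_ord expn_gt0.
  apply: (mulfI mc0); rewrite mulfV // natrC; apply/eqP.
  by rewrite eq_complex /= !mul0r !mulr0 subr0 addr0 mulfV // !eqxx.
by apply/eqP; rewrite eq_complex /= !mul0r !mulr0 subr0 addr0 !eqxx.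
Qed.

(** Linearity turns the double sum of coefficients into one integral against the kernel, to which
    [fejer_approx_real] applies. *)
Lemma fejer_meanE n f y : cube_bounded f ->
  fejer_mean n f y = cube_integral (fun x => f x * (fejer n y x +i* 0)%C).
Proof.
move=> bf.
have bterm k : cube_bounded (fun x => f x * expi (- (2 * pi * dotp k x))).
  apply: cube_boundedM => //.
  have -> : (fun x => expi (- (2 * pi * dotp k x))) = chi (- k).
    by apply/funext => x; rewrite chiN.
  exact: cube_bounded_chi.
have bterm2 k : cube_bounded (fun x =>
    chi k y * (f x * expi (- (2 * pi * dotp k x)))).
  by apply: cube_boundedM => //; exact: cube_bounded_cst.
under eq_fun do rewrite fejer_complex mulrCA mulr_sumr.
rewrite cube_integralZ; last first.
  apply: cube_bounded_sum => a; under eq_fun do rewrite mulr_sumr.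
  by apply: cube_bounded_sum => b; under eq_fun do rewrite mulrCA.
rewrite cube_integral_sum; last first.
  move=> a; under eq_fun do rewrite mulr_sumr.
  by apply: cube_bounded_sum => b; under eq_fun do rewrite mulrCA.
congr (_ * _); apply: eq_bigr => a _.
transitivity (cube_integral (fun x => \sum_(b : P n)
    chi (fr a - fr b) y * (f x * expi (- (2 * pi * dotp (fr a - fr b) x))))).
  rewrite cube_integral_sum //; apply: eq_bigr => b _.
  by rewrite cube_integralZ // mulrC.
congr cube_integral; apply/funext => x; rewrite mulr_sumr.
by apply: eq_bigr => b _; rewrite mulrCA.
Qed.

Lemma continuous_point_bounded f : continuous_point f -> cube_bounded f.
Proof.
move=> [fr fi].
have rowK x : [tuple row_of x ord0 i | i < d] = x.
  by apply: eq_from_tnth => i; rewrite tnth_mktuple mxE.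
have fE : f = (fun x => f [tuple row_of x ord0 i | i < d]).
  by apply/funext => x; rewrite rowK.
have [M hM] := continuous_bounded_cube fr; have [L hL] :=
  continuous_bounded_cube fi.
split.
- by rewrite fE; exact: (continuous_measurable_rV fr).
- by rewrite fE; exact: (continuous_measurable_rV fi).
exists (Num.max M L) => x xc.
by have := hM x xc; have := hL x xc; rewrite rowK !le_max => -> ->;
  rewrite orbT.
Qed.

Lemma normc_le_ReIm (z : R[i]) : normc z <= `|complex.Re z| + `|complex.Im z|.
Proof.
case: z => a b /=; rewrite -[leRHS]ger0_norm ?addr_ge0 // -sqrtr_sqr.
apply: ler_wsqrtr; rewrite sqrrD !real_normK ?num_real //.
by rewrite -addrA [X in _ <= _ + X]addrC addrA lerDl mulrn_wge0 ?mulr_ge0.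
Qed.

Lemma fejer_mean_cvg f y (eps : R) :
  continuous_point f -> periodic_point f -> unit_cube R d y -> 0 < eps ->
  \forall n \near \oo, normc (f y - fejer_mean n f y) <= eps.
Proof.
move=> fc fp yc eps0; have bf := continuous_point_bounded fc.
have [fr fi] := fc.
have e20 : 0 < eps / 2 by rewrite divr_gt0.
have pr : periodic_real (fun x => complex.Re (f x)) by move=> j x; rewrite fp.
have pi' : periodic_real (fun x => complex.Im (f x)) by move=> j x; rewrite fp.
have [n1 h1] := fejer_approx_real fr pr yc e20.
have [n2 h2] := fejer_approx_real fi pi' yc e20.
near=> n.
have n1n : (n1 <= n)%N by near: n; exact: nbhs_infty_ge.
have n2n : (n2 <= n)%N by near: n; exact: nbhs_infty_ge.
rewrite fejer_meanE //; apply: le_trans (normc_le_ReIm _) _.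
rewrite [leRHS]splitr; apply: lerD.
  apply: le_trans (h1 n n1n); rewrite distrC /=.
  case: (f y) => a b /=; rewrite le_eqVlt; apply/orP; left; apply/eqP.
  congr `|_|; congr (_ - _); apply: eq_Rintegral => x _.
  by case: (f x) => a' b' /=; rewrite mulr0 subr0.
apply: le_trans (h2 n n2n); rewrite distrC /=.
case: (f y) => a b /=; rewrite le_eqVlt; apply/orP; left; apply/eqP.
congr `|_|; congr (_ - _); apply: eq_Rintegral => x _.
by case: (f x) => a' b' /=; rewrite mulr0 add0r.
Unshelve. all: by end_near.
Qed.

End FejerMeans.

(** * Error of the lattice algorithm on the Korobov ball *)

Section KorobovCoefficients.
Variables (R : realType) (alpha : R) (gamma : {fset nat} -> R) (d : nat).
Hypothesis gamma_ge0 : forall u, 0 <= gamma u.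
Implicit Types (f : d.-tuple R -> R[i]) (k : freq d).

Lemma freq_prod_gt0 k : 0 < \prod_(j < d | k j != 0) `|(k j)%:~R| `^ alpha :> R.
Proof. by apply: prodr_gt0 => j kj; rewrite powR_gt0 // normr_gt0 intr_eq0. Qed.

Lemma rho_ge0 k : 0 <= rho alpha gamma k.
Proof. by rewrite divr_ge0 // ltW // freq_prod_gt0. Qed.

(** Coefficients normalised to have square sum at most 1 on the ball; where [rho] is 0, division
    makes the value 0. *)
Definition scaled_coef f k : R := normc (fourier f k) / rho alpha gamma k.

Lemma korobov_partial_sum f (F : seq (freq d)) :
  korobov_ball alpha gamma f -> uniq F ->
  (\sum_(k <- F) korobov_r alpha gamma k ^+ 2 * (normc (fourier f k)
    ^+ 2)%:E <= 1)%E.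
Proof.
move=> [_ f1] uF; apply: (@le_trans _ _ (\esum_(k in [set: freq d])
    (korobov_r alpha gamma k ^+ 2 * (normc (fourier f k) ^+ 2)%:E))%E).
  apply: esum_ge; exists [set` F]; first by split => //; exact: finite_seq.
  by rewrite -fsbig_seq.
move: f1; rewrite /korobov_norm; case: (esum _ _) => [r| |] /=;
  last by rewrite leNye.
  rewrite !lee_fin => h; have [r0|r0] := lerP r 0;
    first exact: le_trans r0 ler01.
  by rewrite -[r]sqr_sqrtr ?(ltW r0) // expr_le1 // sqrtr_ge0.
by rewrite leye_eq.
Qed.

(** Where [gamma (supp k)] is 0 the coefficient must vanish, since otherwise its single term would
    make the norm infinite. *)
Lemma coef_le f k : korobov_ball alpha gamma f ->
  normc (fourier f k) <= rho alpha gamma k * scaled_coef f k.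
Proof.
move=> fB; have [g0|g0] := eqVneq (gamma (supp k)) 0; last first.
  rewrite /scaled_coef mulrC divfK // mulf_neq0 ?invr_eq0 //.
  by rewrite gt_eqF // freq_prod_gt0.
have := korobov_partial_sum fB (isT : uniq [:: k]).
rewrite big_seq1 /korobov_r g0 eqxx.
have [c0 _|c0] := eqVneq (normc (fourier f k)) 0.
  by rewrite c0 mulr_ge0 ?rho_ge0 // divr_ge0 ?rho_ge0 // normc_ge0.
have c2 : 0 < normc (fourier f k) ^+ 2.
  by rewrite exprn_gt0 // lt_neqAle eq_sym c0 normc_ge0.
by rewrite expeS /= mulyy gt0_mulye ?lte_fin // leye_eq.
Qed.

Lemma scaled_coef_sum f (F : seq (freq d)) :
  korobov_ball alpha gamma f -> uniq F ->
  \sum_(k <- F) scaled_coef f k ^+ 2 <= 1.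
Proof.
move=> fB uF; have := korobov_partial_sum fB uF.
rewrite -lee_fin -sumEFin; apply: le_trans; apply: lee_sum => k _.
rewrite /korobov_r /scaled_coef /rho; case: eqP => [->|/eqP g0].
  rewrite mul0r invr0 mulr0 expr0n /=; apply: mule_ge0.
    by rewrite mulyy.
  by rewrite lee_fin sqr_ge0.
rewrite -EFin_expe -EFinM lee_fin le_eqVlt; apply/orP; left; apply/eqP.
by rewrite invf_div exprMn mulrC [_^-1 * _]mulrC.
Qed.

End KorobovCoefficients.

Section WorstCase.
Variables (R : realType) (alpha : R) (gamma : {fset nat} -> R) (d N : nat).
Hypothesis gamma_ge0 : forall u, 0 <= gamma u.
Hypothesis N0 : (0 < N)%N.
Variables (z : {ffun 'I_d -> 'I_N}) (A : seq (freq d)).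
Implicit Types (f g : d.-tuple R -> R[i]).

Let L := lattice_algorithm R z N0 A.

Lemma run_latticeB f g x : run L f x - run L g x = run L (fun y => f y - g y) x.
Proof.
rewrite /run /= -sumrB; apply: eq_bigr => k _.
rewrite -mulrBl -mulrBr -sumrB; congr (_ * _ * _); apply: eq_bigr => i _.
by rewrite !ffunE -mulrBl.
Qed.

Lemma run_lattice_sum (I : Type) (r : seq I) (c : R[i]) (G :
  I -> d.-tuple R -> R[i]) x :
  run L (fun y => c * \sum_(a <- r) G a y) x = c * \sum_(a <- r) run L (G a) x.
Proof.
rewrite /run /= exchange_big mulr_sumr; apply: eq_bigr => k _ /=.
transitivity (N%:R^-1 * (c * \sum_(a <- r) \sum_(i < N)
    G a (lattice_point R z i) * chi (- k) (lattice_point R z i)) * chi k x).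
  congr (_ * _ * _); rewrite exchange_big mulr_sumr; apply: eq_bigr => i _ /=.
  by rewrite ffunE -mulrA mulr_suml.
rewrite mulrCA -mulrA; congr (c * _); rewrite mulr_sumr mulr_suml.
apply: eq_bigr => a _; congr (_ * _ * _); apply: eq_bigr => i _.
by rewrite ffunE.
Qed.

(** Stability in the node values: each computed coefficient is an average of them times numbers of
    modulus 1. This lets a Fejer mean be replaced by [f]. *)
Lemma run_lattice_le f (e : R) x :
  (forall i : 'I_N, normc (f (lattice_point R z i)) <= e) ->
  normc (run L f x) <= (size A)%:R * e.
Proof.
move=> fe; have Nr : 0 < N%:R :> R by rewrite ltr0n.
apply: (le_trans (normc_sum _ _ _)).
rewrite -sum1_size natr_sum mulr_suml; apply: ler_sum => k _.
rewrite !Normc.normcM Normc.normcV normc_chi mulr1 mul1r.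
have -> : normc (N%:R : R[i]) = N%:R :> R.
  exact: normc_nat.
rewrite mulrC ler_pdivrMr //; apply: (le_trans (normc_sum _ _ _)).
rewrite -[X in _ <= e * X%:R](card_ord N) mulr_natr -sumr_const;
  apply: ler_sum => i _.
by rewrite ffunE Normc.normcM normc_chi mulr1; exact: fe.
Qed.

(* For fixed [a] the frequencies [fr a - fr b] are distinct, so a Fejer mean of [f]
   is the average over [a] of trigonometric polynomials whose coefficients are
   those of [f]. *)
Lemma lattice_worst_case (E : R) :
  uniq A ->
  (forall F, uniq F ->
     2 * \sum_(h <- F | h \notin A) rho alpha gamma h ^+ 2 +
     2 * (size A)%:R * aliasing A (fun h => rho alpha gamma h ^+ 2) z F <= E) ->
  forall f, korobov_ball alpha gamma f -> forall x, unit_cube R d x ->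
  normc (f x - run L f x) <= Num.sqrt E.
Proof.
move=> uA hE f fB x xc.
have E0 : 0 <= E by have := hE [::] isT;
  rewrite !big_nil /aliasing big_nil !mulr0 addr0.
have [[fc fp _] _] := fB.
have mean_le n : normc (fejer_mean n f x - run L (fejer_mean n f) x)
  <= Num.sqrt E.
  pose G (a : {ffun 'I_d -> 'I_n.+1}) y := \sum_(b : {ffun 'I_d -> 'I_n.+1})
     fourier f (fr a - fr b) * chi (fr a - fr b) y.
  have G_le a : normc (G a x - run L (G a) x) <= Num.sqrt E.
    pose F := [seq fr a - fr b | b <- enum {ffun 'I_d -> 'I_n.+1}].
    have uF : uniq F.
      rewrite map_inj_uniq ?enum_uniq // => b b' /addrI /oppr_inj;
        exact: fr_inj.
    have -> : G a = (fun y => \sum_(h <- F) fourier f h * chi h y).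
      by apply/funext => y; rewrite /G /F big_map big_enum.
    rewrite -[leLHS]ger0_norm ?normc_ge0 // -sqrtr_sqr ler_wsqrtr //.
    have hb h : normc (fourier f h)
      <= rho alpha gamma h * scaled_coef alpha gamma f h.
      exact: coef_le.
    have err := lattice_error z N0 uA (rho_ge0 alpha gamma_ge0 (d := d)) hb
      (scaled_coef_sum fB uF) x.
    exact: (le_trans err (hE F uF)).
  have -> : fejer_mean n f = (fun y =>
    #|{: {ffun 'I_d -> 'I_n.+1}}|%:R^-1 * \sum_a G a y) by [].
  rewrite run_lattice_sum -mulrBr -sumrB Normc.normcM Normc.normcV normc_nat.
  set p := #|_|; have p0 : (0 : R) < p%:R.
    by rewrite ltr0n /p card_ffun !card_ord expn_gt0.
  rewrite mulrC ler_pdivrMr //; apply: (le_trans (normc_sum _ _ _)).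
  rewrite mulr_natr -sumr_const; apply: ler_sum => a _; exact: G_le.
apply/ler_addgt0Pr => e e0.
(* The replacement costs [eta] at [x] and at most |A| eta through the node values. *)
pose eta := e / (1 + (size A)%:R).
have sA : (0 : R) < 1 + (size A)%:R by rewrite ltr_pwDl.
have eta0 : 0 < eta by rewrite divr_gt0.
(* Only [x] and the finitely many nodes matter, so pointwise convergence suffices. *)
have [n [near_x near_pts]] : exists n, normc (f x - fejer_mean n f x) <= eta /\
    forall i : 'I_N, normc (f (lattice_point R z i)
      - fejer_mean n f (lattice_point R z i)) <= eta.
  suff /filter_ex[n [h1 h2]] : \forall n \near \oo,
      normc (f x - fejer_mean n f x) <= eta /\
      forall i : 'I_N, normc (f (lattice_point R z i) -
        fejer_mean n f (lattice_point R z i)) <= eta by exists n.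
  have near_x := fejer_mean_cvg fc fp xc eta0.
  suff near_pts : \forall n \near \oo, forall i : 'I_N,
      normc (f (lattice_point R z i) - fejer_mean n f (lattice_point R z i))
        <= eta.
    near=> n; split; first by near: n.
    by near: n.
  apply: filter_forall => i; apply: fejer_mean_cvg => //.
  exact: lattice_point_cube.
have -> : f x - run L f x = (f x - fejer_mean n f x) +
    ((fejer_mean n f x - run L (fejer_mean n f) x) +
     (run L (fejer_mean n f) x - run L f x)).
  by rewrite !addrA !subrK.
apply: (le_trans (le_normcD _ _)); rewrite addrC.
have : normc (run L (fejer_mean n f) x - run L f x) <= (size A)%:R * eta.
  rewrite run_latticeB; apply: run_lattice_le => i.
  by rewrite -normcN opprB.
have := le_normcD (fejer_mean n f x - run L (fejer_mean n f) x)
     (run L (fejer_mean n f) x - run L f x).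
have := mean_le n.
have -> : e = eta + (size A)%:R * eta.
  by rewrite -{1}[eta]mul1r -mulrDl /eta mulrC divfK // gt_eqF.
move: near_x; lra.
Unshelve. all: by end_near.
Qed.
End WorstCase.

(** * Decay of rho in each coordinate *)

Section DecayOfRho.
Variables (R : realType) (alpha lam C0 : R) (gamma : {fset nat} -> R).
Hypothesis gamma_ge0 : forall u, 0 <= gamma u.
Hypothesis alpha2 : 2^-1 < alpha.
Hypothesis lam0 : 0 < lam.
Hypothesis sumC0 : rho_summable alpha lam gamma C0.

Local Notation rhoA := (rho alpha gamma).

Lemma rho_le d (h : freq d) : rhoA h <= C0 `^ lam^-1.
Proof.
have := sumC0 (isT : uniq [:: h]); rewrite big_seq1 => hC.
have r0 := rho_ge0 alpha gamma_ge0 h.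
have -> : rhoA h = (rhoA h `^ lam) `^ lam^-1.
  by rewrite -powRrM mulfV ?gt_eqF // powRr1.
apply: ge0_ler_powR; rewrite ?nnegrE ?invr_ge0 ?powR_ge0 ?(ltW lam0) //.
exact: le_trans (powR_ge0 _ _) hC.
Qed.

(** Replacing the non-zero entries of [h] by 1 keeps the support, so [rho_le] bounds
    [gamma (supp h)] itself. The product in the denominator of [rho] is at least |h_j|^alpha, and
    alpha > 1/2. *)
Lemma rho_decay d (h : freq d) j :
  rhoA h * `|(h j)%:~R| `^ 2^-1 <= C0 `^ lam^-1.
Proof.
have [hj|hj] := eqVneq (h j) 0.
  by rewrite hj normr0 powR0 ?invr_eq0 // mulr0 powR_ge0.
have ge1 i : h i != 0 -> 1 <= `|(h i)%:~R| :> R.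
  by move=> hi; rewrite -intr_norm ler1z; move: (h i) hi => n; lia.
pose u : freq d := [ffun i => (h i != 0)%:Z].
have su : supp u = supp h.
  rewrite !suppE (_ : [set i | u i != 0]%SET = [set i | h i != 0]%SET) //.
  by apply/setP => i; rewrite !inE ffunE; case: (h i != 0).
apply: le_trans (rho_le u).
have -> : rhoA u = gamma (supp h).
  rewrite /rho su big1 ?invr1 ?mulr1 // => i; rewrite ffunE.
  by case: (h i != 0) => //= _; rewrite normr1 powR1.
have p0 := freq_prod_gt0 alpha h.
rewrite /rho mulrAC ler_pdivrMr // ler_wpM2l //.
rewrite (bigD1 j) //=; apply: (@le_trans _ _ (`|(h j)%:~R| `^ alpha)).
  by apply: ler_powR; [exact: ge1|exact: ltW].
rewrite ler_peMr ?powR_ge0 //; elim/big_ind: _ => // [x y x1 y1|i /andP[hi _]].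
  by rewrite -[leLHS]mulr1 ler_pM.
by rewrite -[leLHS](powRr0 `|(h i)%:~R|); apply: ler_powR;
  [exact: ge1|rewrite (le_trans _ (ltW alpha2)) // invr_ge0].
Qed.

End DecayOfRho.

Section LatticeExistence.
Variables (R : realType) (alpha lam C : R) (gamma : {fset nat} -> R) (d : nat).
Hypothesis gamma_ge0 : forall u, 0 <= gamma u.
Hypothesis lam02 : 0 < lam < 2.
Hypothesis C1 : 1 <= C.

Local Notation rhoA := (@rho R d alpha gamma).

Hypothesis sumC : forall F : seq (freq d), uniq F -> \sum_(h <- F)
  rhoA h `^ lam <= C.
Hypothesis rhoC : forall h : freq d, rhoA h <= C.
Hypothesis decayC : forall (h : freq d) j, rhoA h * `|(h j)%:~R| `^ 2^-1 <= C.

Variables (T : R) (m N : nat).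
Hypothesis T1 : 1 <= T.
Hypothesis mT : (C * T) ^+ 2 <= m%:R.
Hypothesis N0 : (0 < N)%N.

Let theta := 2 - lam.
Let rho0 (h : freq d) : 0 <= rhoA h. Proof. exact: rho_ge0. Qed.

(** Split 2 = theta + lam: the power theta > 0 yields smallness and the power lam stays summable. *)
Lemma rho_sqr_le (h : freq d) (c : R) : 0 <= c -> rhoA h <= c ->
  rhoA h ^+ 2 <= c `^ theta * rhoA h `^ lam.
Proof.
move=> c0 hc; have /andP[l0 l2] := lam02.
rewrite -powR_mulrn // (_ : 2%:R = theta + lam); last by rewrite /theta subrK.
rewrite powRD; last by rewrite /theta subrK pnatr_eq0.
rewrite ler_wpM2r ?powR_ge0 //; apply: ge0_ler_powR; rewrite ?nnegrE //.
by rewrite /theta subr_ge0 ltW.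
Qed.

(** The box makes this a finite list; by [mT] every frequency outside the box has rho <= 1/T, as
    [rho_notin_low] shows. *)
Definition low_freqs : seq (freq d) := [seq k <- box d m | T^-1 <= rhoA k].

Lemma low_freqs_uniq : uniq low_freqs.
Proof. by rewrite filter_uniq // box_uniq. Qed.

Let m0 : (0 : R) < m%:R.
Proof.
apply: lt_le_trans mT; rewrite exprn_gt0 // mulr_gt0 //.
  exact: lt_le_trans C1.
exact: lt_le_trans T1.
Qed.

Lemma rho_far (h : freq d) j :
  (m < absz (h j))%N -> rhoA h <= C * m%:R `^ (- 2^-1).
Proof.
move=> mh; rewrite powRN ler_pdivlMr ?powR_gt0 //.
apply: le_trans (decayC h j); rewrite ler_wpM2l //.
apply: ge0_ler_powR; rewrite ?nnegrE //.
by rewrite -intr_norm -natr_absz ler_nat ltnW.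
Qed.

Lemma rho_notin_low (h : freq d) : h \notin low_freqs -> rhoA h <= T^-1.
Proof.
rewrite mem_filter negb_and -ltNge => /orP[/ltW //|].
rewrite mem_box negb_forall => /existsP[j hj].
have T0 : 0 < T by exact: lt_le_trans T1.
have mh : (m < absz (h j))%N by move: (h j) hj => n; lia.
apply: (le_trans (rho_far mh)).
have CT0 : 0 <= C * T by rewrite mulr_ge0 ?(le_trans ler01).
rewrite powRN ler_pdivrMr ?powR_gt0 // mulrC ler_pdivlMr //.
by rewrite powR12_sqrt // -[C * T]ger0_norm // -sqrtr_sqr ler_wsqrtr.
Qed.

(** Each listed frequency contributes at least T^(-lam) to a sum bounded by C, and lam < 2. *)
Lemma size_low_freqs : (size low_freqs)%:R <= C * T ^+ 2.
Proof.
have T0 : 0 < T by exact: lt_le_trans T1.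
have /andP[l0 l2] := lam02.
have := sumC low_freqs_uniq.
have : \sum_(h <- low_freqs) T `^ (- lam) <= \sum_(h <- low_freqs)
  rhoA h `^ lam.
  rewrite big_seq [leRHS]big_seq; apply: ler_sum => h; rewrite mem_filter =>
    /andP[hT _].
  rewrite -mulN1r powRrM powR_inv1 ?(ltW T0) //.
  by apply: ge0_ler_powR; rewrite ?nnegrE ?invr_ge0 ?(ltW l0) ?(ltW T0).
move=> h1 /(le_trans h1) {h1}.
rewrite big_const_seq count_predT iter_addr_0 -[leLHS]mulr_natl powRN.
rewrite ler_pdivrMr ?powR_gt0 // => /le_trans; apply.
rewrite ler_wpM2l ?(le_trans ler01) // -powR_mulrn ?(ltW T0) //.
by apply: ler_powR => //; exact: ltW.
Qed.

(** [good_generator] applies with w = rho^lam, S = 2m and B = C^2. The size bound C T^2 enters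
    twice, from the error formula and from the average; with C * C^2 from the averaged bound this
    gives C^5 T^4. *)
Lemma lattice_algorithm_exists (E : R) :
  2 * C * T `^ (- theta) + 2 * C ^+ 5 * T ^+ 4 *
    ((m.*2).+1%:R / N%:R + m%:R `^ (- (theta / 2))) <= E ->
  exists (z : {ffun 'I_d -> 'I_N}), forall F, uniq F ->
     2 * \sum_(h <- F | h \notin low_freqs) rhoA h ^+ 2 +
     2 * (size low_freqs)%:R *
       aliasing low_freqs (fun h => rhoA h ^+ 2) z F <= E.
Proof.
move=> EE; have /andP[l0 l2] := lam02.
have T0 : 0 < T by exact: lt_le_trans T1.
have C0 : 0 <= C by exact: le_trans C1.
have Cth : C `^ theta <= C ^+ 2.
  by rewrite -powR_mulrn //; apply: ler_powR => //; rewrite /theta; lra.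
(* By [rho_far], c = C m^(-1/2) bounds rho outside the box, and c^theta <= C^2 m^(-theta/2). *)
pose tau := C ^+ 2 * m%:R `^ (- (theta / 2)).
have tau0 : 0 <= tau by rewrite mulr_ge0 ?exprn_ge0 ?powR_ge0.
have low_box (k : freq d) j : k \in low_freqs -> (absz (k j) * 2 <= m.*2)%N.
  rewrite mem_filter mem_box => /andP[_ /forallP/(_ j)].
  by rewrite -muln2 leq_mul2r -lez_nat abszE.
have rho2B (h : freq d) : rhoA h ^+ 2 <= C ^+ 2 * rhoA h `^ lam.
  apply: (le_trans (rho_sqr_le C0 (rhoC h))).
  by rewrite ler_wpM2r ?powR_ge0.
have rho2_tau (h : freq d) j : (m.*2 < absz (h j) * 2)%N ->
    rhoA h ^+ 2 <= tau * rhoA h `^ lam.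
  move=> mh; have mh' : (m < absz (h j))%N by rewrite -(ltn_pmul2r (m := 2))
    // muln2.
  have c0 : 0 <= C * m%:R `^ (- 2^-1) by rewrite mulr_ge0 ?powR_ge0.
  apply: (le_trans (rho_sqr_le c0 (rho_far mh'))).
  rewrite ler_wpM2r ?powR_ge0 // powRM ?powR_ge0 // -powRrM /tau mulNr.
  by rewrite [_^-1 * theta]mulrC ler_wpM2r ?powR_ge0.
have [z hz] := good_generator N0 low_box (fun h => sqr_ge0 (rhoA h))
  (fun h => powR_ge0 (rhoA h) lam) (exprn_ge0 2 C0) tau0 rho2B rho2_tau sumC.
exists z => F uF; apply: le_trans EE; apply: lerD.
  rewrite -mulrA ler_wpM2l //.
  apply: (@le_trans _ _ (\sum_(h <- F) T `^ (- theta) * rhoA h `^ lam)).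
    rewrite big_mkcond /=; apply: ler_sum => h _; case: ifPn => [hl|_].
      rewrite -mulN1r powRrM powR_inv1 ?(ltW T0) //.
      by apply: rho_sqr_le; rewrite ?invr_ge0 ?(ltW T0) ?rho_notin_low.
    by rewrite mulr_ge0 ?powR_ge0.
  by rewrite -mulr_sumr mulrC ler_wpM2r ?powR_ge0 // sumC.
pose X := (m.*2).+1%:R / N%:R + m%:R `^ (- (theta / 2)) : R.
have X0 : 0 <= X by rewrite addr_ge0 ?divr_ge0 ?powR_ge0.
have sz := size_low_freqs.
have sz0 : (0 : R) <= (size low_freqs)%:R by [].
apply: (@le_trans _ _ (2 * (size low_freqs)%:R * ((size low_freqs)%:R * (C ^+ 3
  * X)))).
  rewrite ler_wpM2l ?mulr_ge0 //; apply: le_trans (hz F uF) _.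
  rewrite ler_wpM2l // le_eqVlt; apply/orP; left; apply/eqP.
  by rewrite /X /tau; ring.
have -> : 2 * C ^+ 5 * T ^+ 4 * X = 2 * (C * T ^+ 2)
  * (C * T ^+ 2 * (C ^+ 3 * X)) by ring.
have CX0 : 0 <= C ^+ 3 * X by rewrite mulr_ge0 ?exprn_ge0.
by apply: ler_pM; rewrite ?mulr_ge0 ?ler_wpM2l ?ler_wpM2r.
Qed.
End LatticeExistence.

(** * Choice of the parameters *)

(** All parameters are powers of y = M/eps: T = y^t, m about y^s, N about y^n. The exponents solve t
    theta = 2, s theta / 2 = 4t + 2 and n = s + 4t + 2, so every error term is of order y^(-2). *)
Lemma parameter_choice (R : realType) (C theta : R)
  : 1 <= C -> 0 < theta <= 2 ->
  exists K p : R, [/\ 0 < K, 0 <= p & forall eps : R, 0 < eps < 1 ->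
    exists (T : R) (m N : nat), [/\ 1 <= T, (C * T) ^+ 2 <= m%:R, (0 < N)%N,
      2 * C * T `^ (- theta) + 2 * C ^+ 5 * T ^+ 4 *
        ((m.*2).+1%:R / N%:R + m%:R `^ (- (theta / 2))) <= eps ^+ 2 &
      N%:R <= K * eps `^ (- p)]].
Proof.
move=> C1 /andP[th0 th2].
have C5 : C <= C ^+ 5 by rewrite -[leLHS]expr1 ler_weXn2l.
(* 14 = 2 + 2 (5 + 1): truncation, then the quotient by N with constant 5 and the power of m with
   constant 1. The total M y^(-2) is at most M^2 y^(-2) = eps^2. *)
pose M := 14 * C ^+ 5.
have M1 : 1 <= M by rewrite /M; lra.
have MC : C <= M by rewrite /M; lra.
have M0 : 0 < M by exact: lt_le_trans M1.
pose t := 2 / theta; pose s := (8 * t + 4) / theta; pose n := s + 4 * t + 2.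
have t1 : 1 <= t by rewrite ler_pdivlMr ?mul1r.
(* This yields (C T)^2 <= y^(2t+2) <= m, using C <= y. *)
have s2t : 2 * t + 2 <= s by rewrite ler_pdivlMr //; nra.
exists (2 * M `^ n), n; split; [by rewrite mulr_gt0 ?powR_gt0|by rewrite /n;
  lra|].
move=> eps /andP[eps0 eps1].
pose y := M / eps.
have y0 : 0 < y by rewrite divr_gt0.
have yM : M <= y by rewrite ler_pdivlMr // ler_piMr ?(ltW M0) // ltW.
have y1 : 1 <= y by exact: le_trans yM.
have yD a b : y `^ (a + b) = y `^ a * y `^ b.
  by rewrite powRD // (gt_eqF y0) implybT.
have ge1 a : 0 <= a -> 1 <= y `^ a.
  by move=> a0; rewrite -(powRr0 y); exact: ler_powR.
have y2 : y `^ (- 2) * M ^+ 2 = eps ^+ 2.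
  by rewrite powR_invn ?(ltW y0) // /y; field; rewrite !gt_eqF.
have above (x : R) : 0 <= x -> x <= (Num.trunc x).+1%:R <= x + 1.
  move=> x0; rewrite ltW ?truncnS_gt //= -addn1 natrD lerD2r.
  by have /andP[] := trunc_itv x0.
have /andP[mlo mhi] := above _ (powR_ge0 y s).
have /andP[Nlo Nhi] := above _ (powR_ge0 y n).
have s0 : 0 <= s by lra.
have n0 : 0 <= n by rewrite /n; lra.
exists (y `^ t), (Num.trunc (y `^ s)).+1, (Num.trunc (y `^ n)).+1.
move: (Num.trunc (y `^ s)).+1 (Num.trunc (y `^ n)) mlo mhi Nlo Nhi =>
  m N mlo mhi Nlo Nhi.
have ys1 := ge1 s s0; have yn1 := ge1 n n0.
have m0 : (0 : R) < m%:R by apply: lt_le_trans mlo; rewrite powR_gt0.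
have T4 : (y `^ t) ^+ 4 = y `^ (4 * t)
  by rewrite -powR_mulrn ?powR_ge0 // -powRrM mulrC.
split=> //; first by apply: ge1; lra.
- apply: le_trans mlo; rewrite exprMn -[(y `^ t)
  ^+ 2]powR_mulrn ?powR_ge0 // -powRrM.
  apply: (@le_trans _ _ (y `^ (2 * t + 2))); last exact: ler_powR.
  rewrite yD mulrC [t * 2]mulrC ler_wpM2l ?powR_ge0 // powR_mulrn ?(ltW y0) //.
  by apply: lerXn2r; rewrite ?nnegrE ?(ltW y0) ?(le_trans _ C1)
    // (le_trans MC yM).
- have -> : (y `^ t) `^ (- theta) = y `^ (- 2).
    by rewrite -powRrM /t; congr (_ `^ _); field; rewrite gt_eqF.
  have hm : m%:R `^ (- (theta / 2)) <= y `^ (- (4 * t + 2)).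
    have -> : - (4 * t + 2) = s * - (theta / 2) by rewrite /s; field;
      rewrite gt_eqF.
    rewrite powRrM !powRN lef_pV2 ?posrE ?powR_gt0 //.
    by apply: ge0_ler_powR; rewrite ?nnegrE ?powR_ge0 ?divr_ge0 ?(ltW th0)
      ?(ltW m0).
  (* Here 2m + 1 <= 2 (y^s + 1) + 1 <= 5 y^s. *)
  have hN : (m.*2).+1%:R / N.+1%:R <= 5 * y `^ (- (4 * t + 2)).
    rewrite ler_pdivrMr //.
    apply: (@le_trans _ _ (5 * y `^ (- (4 * t + 2)) * y `^ n)).
      rewrite -mulrA -yD (_ : _ + n = s); last by rewrite /n; ring.
      by rewrite -addn1 -addnn !natrD; lra.
    by rewrite ler_wpM2l ?mulr_ge0 ?powR_ge0.
  apply: (@le_trans _ _ (14 * C ^+ 5 * y `^ (- 2))).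
    have -> : 14 * C ^+ 5 * y `^ (- 2) = 2 * C ^+ 5 * y `^ (- 2) +
       2 * C ^+ 5 * y `^ (4 * t) * (6 * y `^ (- (4 * t + 2))).
      have -> : y `^ (- 2) = y `^ (4 * t) * y `^ (- (4 * t + 2)).
        by rewrite -yD; congr (_ `^ _); ring.
      by ring.
    rewrite T4; apply: lerD.
      by rewrite ler_wpM2r ?powR_ge0 // ler_wpM2l.
    rewrite ler_wpM2l ?mulr_ge0 ?powR_ge0 ?exprn_ge0 ?(le_trans _ C1) //.
    by apply: (le_trans (lerD hN hm)); lra.
  rewrite -y2 [leRHS]mulrC ler_wpM2r ?powR_ge0 // -/M expr2 ler_peMl //;
    exact: ltW.
- apply: (le_trans Nhi); apply: (@le_trans _ _ (2 * y `^ n)); first by lra.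
  rewrite -mulrA ler_wpM2l // /y powRM ?invr_ge0 ?(ltW M0) ?(ltW eps0) //.
  by rewrite -powR_inv1 ?(ltW eps0) // -powRrM mulN1r.
Qed.

(** * From the error bound to tractability *)

Section Tractable.
Variables (R : realType) (alpha : R) (gamma : {fset nat} -> R).
Hypothesis gamma_ge0 : forall u, 0 <= gamma u.

Lemma run_lattice_bounded d N (z : {ffun 'I_d -> 'I_N}) (N0 : (0 < N)%N) A f :
  cube_bounded (run (lattice_algorithm R z N0 A) f).
Proof.
apply: cube_bounded_sum => k; apply: cube_boundedM;
  last exact: cube_bounded_chi.
exact: cube_bounded_cst.
Qed.

Lemma error_Linf_le d N (L : algorithm R N d) (eps : R) :
  (forall f, korobov_ball alpha gamma f -> forall x, unit_cube R d x ->
     normc (f x - run L f x) <= eps) ->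
  (error_Linf alpha gamma L <= eps%:E)%E.
Proof.
move=> h; apply: ge_ereal_sup => _ [f fB <-]; apply: ge_ereal_sup =>
  _ [x xc <-].
by rewrite lee_fin h.
Qed.

Lemma normc_sqr (z : R[i])
  : normc z ^+ 2 = complex.Re z ^+ 2 + complex.Im z ^+ 2.
Proof. by case: z => a b /=; rewrite sqr_sqrtr // addr_ge0 ?sqr_ge0. Qed.

(** The algorithm is constant in the random element and the cube has measure 1, so a uniform
    pointwise bound passes to the root mean square. *)
Lemma error_rms_L2_le d N (L : algorithm R N d) (eps : R) :
  (forall f, cube_bounded (run L f)) -> 0 <= eps ->
  (forall f, korobov_ball alpha gamma f -> forall x, unit_cube R d x ->
     normc (f x - run L f x) <= eps) ->
  (error_rms_L2 alpha gamma (uniform_prob (@ltr01 R)) (fun=> L) <= eps%:E)%E.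
Proof.
move=> bL eps0 h; apply: ge_ereal_sup => _ [f fB <-].
have [[fc _ _] _] := fB.
have bd : cube_bounded (fun x => f x - run L f x).
  have -> : (fun x => f x - run L f x) = (fun x => f x + (-1) * run L f x).
    by apply/funext => x; rewrite mulN1r.
  apply: cube_boundedD; first exact: continuous_point_bounded.
  by apply: cube_boundedM => //; exact: cube_bounded_cst.
have inner : (\int[cube_measure R d]_(x in unit_cube R d)
    ((normc (f x - run L f x)) ^+ 2)%:E <= (eps ^+ 2)%:E)%E.
  apply: (@le_trans _ _ (\int[cube_measure R d]_(x in unit_cube R d)
    (cst (eps ^+ 2)%:E x))%E).
    apply: ge0_le_integral => //; first exact: measurable_unit_cube.
    - by move=> x _; rewrite lee_fin sqr_ge0.
    - apply/measurable_EFinP; under eq_fun do rewrite normc_sqr.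
      apply: measurable_funTS; have [mr mi _] := bd.
      by apply: measurable_funD; apply: measurable_funX.
    - move=> x xc; rewrite lee_fin; apply: lerXn2r;
      rewrite ?nnegrE ?normc_ge0 //.
      exact: h.
  rewrite integral_cst; last exact: measurable_unit_cube.
  by rewrite -[X in (_ * X)%E]/(cube_measure R d (unit_cube R d))
    cube_measure_cube mule1.
have : (\int[uniform_prob (@ltr01 R)]_w \int[cube_measure R d]_(x in unit_cube
  R d)
    ((normc (f x - run L f x)) ^+ 2)%:E <= (eps ^+ 2)%:E)%E.
  rewrite integral_cst //.
  by rewrite -[X in (_ * X)%E]/(uniform_prob (@ltr01 R) setT)
    probability_setT mule1.
set I := (\int[_]_w _)%E; case: I => [r| |] /=.
- by rewrite !lee_fin => /ler_wsqrtr; rewrite sqrtr_sqr ger0_norm.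
- by rewrite leye_eq.
- by rewrite lee_fin.
Qed.

Lemma rho_summable_tractable (lam C0 : R) : 2^-1 < alpha -> 0 < lam < 2 ->
  rho_summable alpha lam gamma C0 ->
  strongly_polynomially_tractable (complexity_det_Linf alpha gamma) /\
  strongly_polynomially_tractable (complexity_ran_L2 alpha gamma).
Proof.
move=> alpha2 lam02 sumC0; have /andP[lam0 lam2] := lam02.
(* One constant for all demands: at least 1, the summability constant [C0], and the bound C0^(1/lam)
   of [rho_le] and [rho_decay]. *)
pose C := Num.max 1 (Num.max C0 (C0 `^ lam^-1)).
have C1 : 1 <= C by rewrite le_max lexx.
have th : 0 < 2 - lam <= 2 by rewrite subr_gt0 lam2 /=; lra.
have [K [p [K0 p0 hKp]]] := parameter_choice C1 th.
have key (eps : R) d : 0 < eps < 1 -> exists N (L : algorithm R N d),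
    [/\ N%:R <= K * eps `^ (- p), (forall f, cube_bounded (run L f)) &
    forall f, korobov_ball alpha gamma f -> forall x, unit_cube R d x ->
     normc (f x - run L f x) <= eps].
  move=> eps01; have [T [m [N [T1 mT N0 hE hN]]]] := hKp eps eps01.
  have sumC (F : seq (freq d)) : uniq F -> \sum_(h <- F)
    rho alpha gamma h `^ lam <= C.
    by move=> uF; apply: (le_trans (sumC0 d F uF)); rewrite !le_max lexx orbT.
  have rhoC (h : freq d) : rho alpha gamma h <= C.
    by apply: (le_trans (rho_le gamma_ge0 lam0 sumC0 h));
      rewrite !le_max lexx !orbT.
  have decayC (h : freq d) j : rho alpha gamma h * `|(h j)%:~R| `^ 2^-1 <= C.
    apply: (le_trans (rho_decay gamma_ge0 alpha2 lam0 sumC0 h j)).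
    by rewrite !le_max lexx !orbT.
  have [z hz] := lattice_algorithm_exists gamma_ge0 lam02 C1 sumC rhoC decayC
    T1 mT N0 hE.
  exists N, (lattice_algorithm R z N0 (low_freqs alpha gamma d T m)); split =>
    //.
    by move=> f; exact: run_lattice_bounded.
  move=> f fB x xc.
  have /andP[/ltW eps0 _] := eps01.
  rewrite -[eps]ger0_norm // -sqrtr_sqr.
  by apply: (lattice_worst_case gamma_ge0 N0 _ hz fB xc); exact: low_freqs_uniq.
split; exists K, p; split => // eps d eps01 _; have [N [L [hN bL hL]]] :=
  key eps d eps01.
  apply: (@le_trans _ _ (N%:R)%:E); last by rewrite lee_fin.
  apply: ereal_inf_lbound; exists N => //; exists L; exact: error_Linf_le.
apply: (@le_trans _ _ (N%:R)%:E); last by rewrite lee_fin.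
apply: ereal_inf_lbound; exists N => //.
exists _, (measurableTypeR R), (uniform_prob (@ltr01 R)), (fun=> L); split.
  move=> f _; have [mr mi _] := bL f.
  by split; apply: measurable_funTS;
    [exact: (measurableT_comp mr)|exact: (measurableT_comp mi)].
by apply: error_rms_L2_le => //; have /andP[/ltW] := eps01.
Qed.

End Tractable.

Theorem corollary4p11 (R : realType) (alpha : R) (gamma : {fset nat} -> R)
    (alpha_gt : 2^-1 < alpha)
    (gamma_ge0 : forall u : {fset nat}, 0 <= gamma u)
    (gamma0 : gamma fset0 = 1) :
  (forall g : nat -> R,
     (forall j, 0 <= g j) ->
     product_weights gamma g ->
     (exists lambda : R, alpha^-1 < lambda < 2 /\
        (\sum_(0 <= j <oo) (g j `^ lambda)%:E < +oo)%E) ->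
     strongly_polynomially_tractable (complexity_det_Linf alpha gamma) /\
     strongly_polynomially_tractable (complexity_ran_L2 alpha gamma)) /\
  (forall g Gam : nat -> R,
     (forall j, 0 <= g j) ->
     (forall l, 0 <= Gam l) ->
     pod_weights gamma Gam g ->
     (exists c lambda : R, [/\ 0 < c, alpha^-1 < lambda < 2,
        (2%:E * zeta (alpha * lambda) *
           \sum_(0 <= j <oo) (g j `^ lambda)%:E < 1)%E &
        forall l : nat, (0 < l)%N ->
          Gam l <= c * (l`!)%:R `^ lambda^-1]) ->
     strongly_polynomially_tractable (complexity_det_Linf alpha gamma) /\
     strongly_polynomially_tractable (complexity_ran_L2 alpha gamma)).
Proof.
have alpha0 : 0 < alpha by apply: lt_trans alpha_gt; rewrite invr_gt0.
split=> [g g0 gE [lam [/andP[alam lam2] Sfin]]|].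
  have lam0 : 0 < lam by apply: lt_trans alam; rewrite invr_gt0.
  have [C hC] := product_rho_summable alpha0 alam g0 gE Sfin.
  by apply: (rho_summable_tractable gamma_ge0 alpha_gt _ hC); rewrite lam0.
move=> g Gam g0 Gam0 gE [c [lam [c0 /andP[alam lam2] Slt Gamle]]].
have lam0 : 0 < lam by apply: lt_trans alam; rewrite invr_gt0.
have [C hC] := pod_rho_summable alpha0 alam gamma0 c0 g0 Gam0 gE Slt Gamle.
by apply: (rho_summable_tractable gamma_ge0 alpha_gt _ hC); rewrite lam0.
Qed.
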